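(* There exists $\kappa\in C^{1,1/2}_c(\mathbb{R}^2;\mathbb{R})$ such that the kernel $K=\nabla^\perp\kappa=(-\partial_2\kappa,\partial_1\kappa)$ admits a flow $X$ (of $\mathcal{H}^1_I$, in the sense below) with $X(0,x)=x$ for all $x\in I$ and $X(t,I)=\{0\}$ for all sufficiently large $t>0$.
   Context: Let $I=[-1,1]\times\{0\}\subset\mathbb{R}^2$ and $\mathcal{H}^1_I$ the one-dimensional Hausdorff measure restricted to $I$. Given $K\in C(\mathbb{R}^2;\mathbb{R}^2)$, $K$ admits a flow $X\in C([0,\infty)\times I;\mathbb{R}^2)$, differentiable with respect to $t$, if $u(t,x)\coloneqq\int_I K(x-X(t,a))\,d\mathcal{H}^1_I(a)$ exists for all $t\in[0,\infty)$ and $x\in X(t,I)$, and $X$ is a trajectory map for $u$ on $I$, i.e. for every $a\in I$, $t\mapsto X(t,a)$ is differentiable for all $t\ge0$ with $\partial_tX(t,a)=u(t,X(t,a))$ and $X(0,a)=a$. *)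

(* Defs.v *)
From Stdlib Require Import Reals Lra.
Open Scope R_scope.

Definition pt := (R * R)%type.

Definition vadd (x y : pt) : pt := (fst x + fst y, snd x + snd y).
Definition vsub (x y : pt) : pt := (fst x - fst y, snd x - snd y).
Definition norm2 (x : pt) : R := sqrt (fst x * fst x + snd x * snd x).

Definition is_partials (k g1 g2 : pt -> R) : Prop :=
  forall x y : R,
    derivable_pt_lim (fun r => k (r, y)) x (g1 (x, y)) /\
    derivable_pt_lim (fun r => k (x, r)) y (g2 (x, y)).

Definition continuous2 (f : pt -> R) : Prop :=
  forall x : pt, forall eps, 0 < eps -> exists delta, 0 < delta /\
    forall y : pt, norm2 (vsub y x) < delta -> Rabs (f y - f x) < eps.

Definition C11half_c (k g1 g2 : pt -> R) : Prop :=
  is_partials k g1 g2 /\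
  continuous2 g1 /\ continuous2 g2 /\
  (exists C, 0 <= C /\ forall x y : pt,
       norm2 (g1 x - g1 y, g2 x - g2 y) <= C * sqrt (norm2 (vsub x y))) /\
  (exists Rs, 0 < Rs /\ forall x : pt, Rs <= norm2 x -> k x = 0).

Definition perp_grad (g1 g2 : pt -> R) : pt -> pt :=
  fun z => (- g2 z, g1 z).

(* A point a = (s,0) of I = [-1,1] x {0} is parametrised by s in [-1,1];
   X t s stands for X(t,(s,0)). *)
Definition inI (s : R) : Prop := -1 <= s <= 1.

Definition flow_continuous (X : R -> R -> pt) : Prop :=
  forall t s, 0 <= t -> inI s ->
  forall eps, 0 < eps -> exists delta, 0 < delta /\
    forall t' s', 0 <= t' -> inI s' -> Rabs (t' - t) < delta -> Rabs (s' - s) < delta ->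
      norm2 (vsub (X t' s') (X t s)) < eps.

Definition deriv_half_line (f : R -> R) (t l : R) : Prop :=
  forall eps, 0 < eps -> exists delta, 0 < delta /\
    forall h, h <> 0 -> 0 <= t + h -> Rabs h < delta ->
      Rabs ((f (t + h) - f t) / h - l) < eps.

Definition has_integral (f : R -> R) (a b v : R) : Prop :=
  exists pr : Riemann_integrable f a b, RiemannInt pr = v.

(* u(t,x) = \int_I K(x - X(t,a)) dH^1_I(a) exists and equals v *)
Definition velocity (K : pt -> pt) (X : R -> R -> pt) (t : R) (x v : pt) : Prop :=
  has_integral (fun s => fst (K (vsub x (X t s)))) (-1) 1 (fst v) /\
  has_integral (fun s => snd (K (vsub x (X t s)))) (-1) 1 (snd v).

Definition admits_flow (K : pt -> pt) (X : R -> R -> pt) : Prop :=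
  flow_continuous X /\
  (forall t x, 0 <= t -> (exists s, inI s /\ X t s = x) ->
     exists v, velocity K X t x v) /\
  (forall s, inI s -> X 0 s = (s, 0)) /\
  (forall t s, 0 <= t -> inI s ->
     exists v, velocity K X t (X t s) v /\
       deriv_half_line (fun r => fst (X r s)) t (fst v) /\
       deriv_half_line (fun r => snd (X r s)) t (snd v)).

(* Main.v *)
Require Import Defs.
From Stdlib Require Import Reals ZArith Lra Lia Psatz.
From Coquelicot Require Import Coquelicot.
Open Scope R_scope.

(** The kernel is built so that the segment never leaves the axis: near the
    origin [kappa = x y / |z|^(1/2)] is homogeneous of degree 3/2, so its gradient
    is 1/2-Hoelder, and on the axis [K (x, 0) = (F x, 0)] with [F] odd,
    decreasing and [F x <= - sqrt x] for [x >= 0]. The flow is then [(Y t s, 0)]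
    with [dY/dt (t, s) = int F (Y t s - Y t a) da]. Since [F] is decreasing this
    equation is dissipative in the sup norm, so the explicit Euler schemes form a
    Cauchy sequence although [F] is not Lipschitz. At the rightmost particle,
    at position [c], the velocity is at most [- sqrt (2 c)], so that all particles
    reach the origin in finite time. *)

(** * The kernel *)

(** Dissipativity takes their place, but it is a property of implicit steps: it acts where the
    difference of the new positions is maximal. An explicit step of length [h] is an implicit one up
    to an error [h * O(sqrt h)], by Hoelder continuity of the drift, and [t / h] such errors add up
    to [O(t * sqrt h)] because nothing amplifies them. The step [4^-k] turns this into a geometric
    series in [2^-k]. Extinction is obtained without differentiating the maximum of the
    trajectories, again by looking back from the later time. The oddness of [F] keeps the mean
    position at 0, which is what bounds the attraction at the rightmost particle from below. *)

Lemma norm2_pos (z : pt) : 0 <= norm2 z.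
Proof. apply sqrt_pos. Qed.

Lemma norm2_sqr (z : pt) : norm2 z * norm2 z = fst z * fst z + snd z * snd z.
Proof. apply sqrt_sqrt. nra. Qed.

Lemma norm2_le (z : pt) (c : R) :
  0 <= c -> fst z * fst z + snd z * snd z <= c * c -> norm2 z <= c.
Proof.
  intros Hc Hz. rewrite <- (sqrt_square c) by assumption. now apply sqrt_le_1_alt.
Qed.

Lemma norm2_eq_0 (z : pt) : norm2 z = 0 -> z = (0, 0).
Proof.
  intros Hz. generalize (norm2_sqr z). rewrite Hz. destruct z as [x y]; simpl.
  intros H. f_equal; nra.
Qed.

Lemma abs_fst_le_norm2 (z : pt) : Rabs (fst z) <= norm2 z.
Proof. rewrite <- sqrt_Rsqr_abs. apply sqrt_le_1_alt. unfold Rsqr. nra. Qed.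

Lemma norm2_le_abs (a b : R) : norm2 (a, b) <= Rabs a + Rabs b.
Proof.
  apply norm2_le; simpl; generalize (Rabs_pos a) (Rabs_pos b); [lra|].
  assert (Ha : Rabs a * Rabs a = a * a) by (rewrite <- Rabs_mult; apply Rabs_pos_eq; nra).
  assert (Hb : Rabs b * Rabs b = b * b) by (rewrite <- Rabs_mult; apply Rabs_pos_eq; nra).
  nra.
Qed.

Lemma norm2_axis (a : R) : norm2 (a, 0) = Rabs a.
Proof.
  unfold norm2; simpl. rewrite Rmult_0_l, Rplus_0_r. apply sqrt_Rsqr_abs.
Qed.

Lemma vsub_axis (a b : R) : vsub (a, 0) (b, 0) = (a - b, 0).
Proof. unfold vsub; simpl. now rewrite Rminus_diag. Qed.

Lemma norm2_triangle (x y : pt) : norm2 x <= norm2 y + norm2 (vsub x y).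
Proof.
  generalize (norm2_pos y) (norm2_pos (vsub x y)) (norm2_sqr y) (norm2_sqr (vsub x y)).
  set (p := norm2 y). set (q := norm2 (vsub x y)).
  destruct x as [x1 x2], y as [y1 y2]; unfold vsub; simpl. intros Hp Hq Hpp Hqq.
  apply norm2_le; simpl; [lra|].
  assert (Hcs : y1 * (x1 - y1) + y2 * (x2 - y2) <= p * q).
  { apply Rsqr_incr_0_var; [unfold Rsqr | nra].
    replace (p * q * (p * q)) with ((p * p) * (q * q)) by ring.
    rewrite Hpp, Hqq.
    generalize (Rle_0_sqr (y1 * (x2 - y2) - y2 * (x1 - y1))). unfold Rsqr. lra. }
  nra.
Qed.

Lemma norm2_dist (x y : pt) : Rabs (norm2 x - norm2 y) <= norm2 (vsub x y).
Proof.
  generalize (norm2_triangle x y) (norm2_triangle y x).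
  assert (Hsym : norm2 (vsub y x) = norm2 (vsub x y))
    by (unfold norm2, vsub; simpl; f_equal; ring).
  rewrite Hsym. intros. apply Rabs_le_between. lra.
Qed.

(** * Degree 0 estimates and Hoelder continuity *)

Definition flip (z : pt) : pt := (snd z, fst z).

Lemma norm2_flip (z : pt) : norm2 (flip z) = norm2 z.
Proof. unfold norm2, flip; simpl. f_equal; ring. Qed.

(* The estimates satisfied by functions that are smooth and homogeneous of
   degree 0 away from the origin. *)
Definition degree0 (f : pt -> R) : Prop :=
  exists C, 0 <= C /\ (forall x, Rabs (f x) <= C) /\
    forall x y, norm2 y <= norm2 x ->
      norm2 x * Rabs (f x - f y) <= C * norm2 (vsub x y).

Lemma degree0_const (c : R) : degree0 (fun _ => c).
Proof.
  exists (Rabs c). split; [apply Rabs_pos|]. split; [intros; lra|].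
  intros x y _. rewrite Rminus_diag, Rabs_R0, Rmult_0_r.
  apply Rmult_le_pos; [apply Rabs_pos | apply norm2_pos].
Qed.

Lemma degree0_minus (f g : pt -> R) :
  degree0 f -> degree0 g -> degree0 (fun z => f z - g z).
Proof.
  intros [C [HC [Hf Hf']]] [D [HD [Hg Hg']]]. exists (C + D).
  split; [lra|]. split.
  - intros x. unfold Rminus. eapply Rle_trans; [apply Rabs_triang|].
    rewrite Rabs_Ropp. now apply Rplus_le_compat.
  - intros x y Hxy. specialize (Hf' x y Hxy). specialize (Hg' x y Hxy).
    replace (f x - g x - (f y - g y)) with ((f x - f y) + - (g x - g y)) by ring.
    assert (Htri := Rabs_triang (f x - f y) (- (g x - g y))).
    rewrite Rabs_Ropp in Htri. generalize (norm2_pos x). nra.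
Qed.

Lemma degree0_mult (f g : pt -> R) :
  degree0 f -> degree0 g -> degree0 (fun z => f z * g z).
Proof.
  intros [C [HC [Hf Hf']]] [D [HD [Hg Hg']]]. exists (2 * (C * D)).
  assert (HCD : 0 <= C * D) by now apply Rmult_le_pos.
  split; [lra|]. split.
  - intros x. rewrite Rabs_mult.
    generalize (Rmult_le_compat _ _ _ _ (Rabs_pos (f x)) (Rabs_pos (g x)) (Hf x) (Hg x)). lra.
  - intros x y Hxy. specialize (Hf' x y Hxy). specialize (Hg' x y Hxy).
    replace (f x * g x - f y * g y) with ((f x - f y) * g x + f y * (g x - g y)) by ring.
    eapply Rle_trans.
    { apply Rmult_le_compat_l; [apply norm2_pos | apply Rabs_triang]. }
    rewrite !Rabs_mult, Rmult_plus_distr_l.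
    assert (Hn := norm2_pos x). specialize (Hf y). specialize (Hg x).
    assert (H1 : norm2 x * (Rabs (f x - f y) * Rabs (g x)) <= C * norm2 (vsub x y) * D).
    { rewrite <- Rmult_assoc. apply Rmult_le_compat; auto using Rabs_pos.
      apply Rmult_le_pos; auto using Rabs_pos. }
    assert (H2 : norm2 x * (Rabs (f y) * Rabs (g x - g y)) <= C * (D * norm2 (vsub x y))).
    { replace (norm2 x * (Rabs (f y) * Rabs (g x - g y)))
        with (Rabs (f y) * (norm2 x * Rabs (g x - g y))) by ring.
      apply Rmult_le_compat; auto using Rabs_pos.
      apply Rmult_le_pos; auto using Rabs_pos. }
    lra.
Qed.

Lemma degree0_flip (f : pt -> R) : degree0 f -> degree0 (fun z => f (flip z)).
Proof.
  intros [C [HC [Hf Hf']]]. exists C. split; [exact HC|]. split; [auto|].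
  intros x y Hxy. rewrite <- (norm2_flip x), <- (norm2_flip (vsub x y)).
  apply (Hf' (flip x) (flip y)). now rewrite !norm2_flip.
Qed.

Lemma degree0_direction : degree0 (fun z => fst z / norm2 z).
Proof.
  exists 2. split; [lra|]. split.
  - intros x. assert (Ha := abs_fst_le_norm2 x).
    destruct (Req_dec (norm2 x) 0) as [H0|H0].
    (* The numerator vanishes at the origin, so the quotient is 0 there whatever [/ 0] is. *)
    { rewrite (norm2_eq_0 x H0). simpl. unfold Rdiv.
      rewrite Rmult_0_l, Rabs_R0. lra. }
    assert (Hp : 0 < norm2 x) by (generalize (norm2_pos x); lra).
    unfold Rdiv. rewrite Rabs_mult, Rabs_inv, (Rabs_pos_eq (norm2 x)) by lra.
    apply (Rmult_le_reg_r (norm2 x)); [exact Hp|].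
    rewrite Rmult_assoc, Rinv_l by lra. lra.
  - intros x y Hxy.
    assert (Hn := norm2_dist x y). assert (Hd := abs_fst_le_norm2 (vsub x y)).
    unfold vsub in Hd at 1; simpl in Hd.
    assert (Hx := norm2_pos x). assert (Hy := norm2_pos y).
    assert (Hax := abs_fst_le_norm2 x). assert (Hay := abs_fst_le_norm2 y).
    destruct (Req_dec (norm2 x) 0) as [Hx0|Hx0].
    { rewrite Hx0, Rmult_0_l. generalize (norm2_pos (vsub x y)). lra. }
    destruct (Req_dec (norm2 y) 0) as [Hy0|Hy0].
    { assert (Hz := norm2_eq_0 y Hy0). subst y. simpl fst in *.
      unfold Rdiv. rewrite Rmult_0_l, Rminus_0_r, Rabs_mult, Rabs_inv, (Rabs_pos_eq (norm2 x)) by lra.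
      replace (norm2 x * (Rabs (fst x) * / norm2 x)) with (Rabs (fst x)) by (field; lra).
      rewrite Rminus_0_r in Hd. generalize (norm2_pos (vsub x (0, 0))). lra. }
    rewrite <- (Rabs_pos_eq (norm2 x)) at 1 by lra. rewrite <- Rabs_mult.
    replace (norm2 x * (fst x / norm2 x - fst y / norm2 y))
      with ((fst x - fst y) + - (fst y / norm2 y * (norm2 x - norm2 y))) by (field; lra).
    eapply Rle_trans; [apply Rabs_triang|]. rewrite Rabs_Ropp, Rabs_mult.
    assert (H1 : Rabs (fst y / norm2 y) <= 1).
    { unfold Rdiv. rewrite Rabs_mult, Rabs_inv, (Rabs_pos_eq (norm2 y)) by lra.
      apply (Rmult_le_reg_r (norm2 y)); [lra|].
      rewrite Rmult_assoc, Rinv_l by lra. lra. }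
    generalize (Rabs_pos (norm2 x - norm2 y)). nra.
Qed.

(** It enters [kappa] squared, hence continuously differentiable. The radius 8 serves
    [kappa2_axis_monotone]: [sqrt x * (R^2 - x^2)^2] increases only up to [R / 3], and two points of
    the segment can be 2 apart. *)
Definition cutoff (z : pt) : R := Rmax 0 (64 - (fst z * fst z + snd z * snd z)).

Lemma cutoff_norm2 (z : pt) : cutoff z = Rmax 0 (64 - norm2 z * norm2 z).
Proof. unfold cutoff. now rewrite norm2_sqr. Qed.

Lemma cutoff_flip (z : pt) : cutoff (flip z) = cutoff z.
Proof. unfold cutoff, flip; simpl. f_equal; ring. Qed.

(** Compact support replaces homogeneity. If both points lie in the disc, the function is Lipschitz
    and [norm2 x] is at most 8; if only [y] does, [(8 - b) * a <= 8 * (a - b)] because [a > 8]. *)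
Lemma degree0_cutoff : degree0 cutoff.
Proof.
  exists 128. split; [lra|]. split.
  - intros x. rewrite cutoff_norm2. generalize (norm2_pos x). intros Hx.
    rewrite Rabs_pos_eq by apply Rmax_l. apply Rmax_lub; nra.
  - intros x y Hxy. rewrite !cutoff_norm2.
    eapply Rle_trans; [|apply Rmult_le_compat_l; [lra | apply norm2_dist]].
    assert (Hy := norm2_pos y).
    set (a := norm2 x) in *. set (b := norm2 y) in *.
    rewrite (Rabs_pos_eq (a - b)) by lra.
    unfold Rmax. repeat destruct Rle_dec.
    + rewrite Rabs_left1 by nra. assert (a <= 8) by nra.
      replace (a * - (64 - a * a - (64 - b * b))) with ((a - b) * (a * (a + b))) by ring.
      rewrite (Rmult_comm 128). apply Rmult_le_compat_l; nra.
    + nra.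
    + assert (b <= 8) by nra. assert (8 < a) by nra.
      rewrite Rminus_0_l, Rabs_left1 by nra.
      replace (a * - - (64 - b * b)) with ((8 + b) * ((8 - b) * a)) by ring.
      assert ((8 - b) * a <= 8 * (a - b)) by nra.
      assert (0 <= (8 - b) * a) by nra. nra.
    + rewrite Rminus_diag, Rabs_R0. nra.
Qed.

Lemma sqrt_dist (a b : R) : 0 <= a -> 0 <= b -> Rabs (sqrt a - sqrt b) <= sqrt (Rabs (a - b)).
Proof.
  assert (Hone : forall a b, 0 <= a -> 0 <= b -> sqrt a <= sqrt b + sqrt (Rabs (a - b))).
  { clear. intros a b Ha Hb. generalize (sqrt_pos b) (sqrt_pos (Rabs (a - b))).
    intros H1 H2. rewrite <- (sqrt_square (sqrt b + sqrt (Rabs (a - b)))) by lra.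
    apply sqrt_le_1_alt.
    assert (H3 := sqrt_sqrt b Hb). assert (H4 := sqrt_sqrt _ (Rabs_pos (a - b))).
    generalize (Rle_abs (a - b)). nra. }
  intros Ha Hb. generalize (Hone a b Ha Hb) (Hone b a Hb Ha).
  rewrite (Rabs_minus_sym b a). intros. apply Rabs_le_between. lra.
Qed.

(** Let [x] be the point farther from the origin. If [|x - y| >= |x|], boundedness of [f] is enough.
    Otherwise [sqrt |x| * |f x - f y| <= C * |x - y| / sqrt |x| <= C * sqrt |x - y|]. The variation
    of the factor [sqrt |z|] is handled by [sqrt_dist]. *)
Lemma sqrt_norm2_mult_holder (f : pt -> R) :
  degree0 f -> exists C, 0 <= C /\ forall x y,
    Rabs (sqrt (norm2 x) * f x - sqrt (norm2 y) * f y) <= C * sqrt (norm2 (vsub x y)).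
Proof.
  intros [C [HC [Hf Hf']]]. exists (3 * C). split; [lra|].
  assert (Hone : forall x y, norm2 y <= norm2 x ->
    Rabs (sqrt (norm2 x) * f x - sqrt (norm2 y) * f y) <= 3 * C * sqrt (norm2 (vsub x y))).
  { intros x y Hxy. specialize (Hf' x y Hxy).
    assert (Hy := norm2_pos y). assert (Hd := norm2_pos (vsub x y)).
    assert (Hr : Rabs (sqrt (norm2 x) - sqrt (norm2 y)) <= sqrt (norm2 (vsub x y))).
    { eapply Rle_trans; [apply sqrt_dist; lra|].
      apply sqrt_le_1_alt, norm2_dist. }
    assert (Hs : sqrt (norm2 x) * Rabs (f x - f y) <= 2 * C * sqrt (norm2 (vsub x y))).
    { assert (Hx := norm2_pos x).
      assert (Hxx := sqrt_sqrt _ Hx). assert (Hdd := sqrt_sqrt _ Hd).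
      assert (Hp := sqrt_pos (norm2 x)). assert (Hq := sqrt_pos (norm2 (vsub x y))).
      set (p := sqrt (norm2 x)) in *. set (q := sqrt (norm2 (vsub x y))) in *.
      assert (Hfd : Rabs (f x - f y) <= 2 * C).
      { unfold Rminus. eapply Rle_trans; [apply Rabs_triang|].
        rewrite Rabs_Ropp. generalize (Hf x) (Hf y). lra. }
      generalize (Rabs_pos (f x - f y)). intros Hfp.
      destruct (Rle_lt_dec p q) as [Hpq|Hpq]; [nra|].
      rewrite <- Hxx, <- Hdd in Hf'.
      apply (Rmult_le_reg_l p); [lra|].
      apply Rle_trans with (C * (q * q)); [lra|].
      assert (0 <= C * q) by nra. nra. }
    replace (sqrt (norm2 x) * f x - sqrt (norm2 y) * f y)
      with (sqrt (norm2 x) * (f x - f y) + (sqrt (norm2 x) - sqrt (norm2 y)) * f y) by ring.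
    eapply Rle_trans; [apply Rabs_triang|].
    rewrite !Rabs_mult, (Rabs_pos_eq (sqrt (norm2 x))) by apply sqrt_pos.
    assert (Hm := Rmult_le_compat _ _ _ _ (Rabs_pos _) (Rabs_pos _) Hr (Hf y)). lra. }
  intros x y. destruct (Rle_lt_dec (norm2 y) (norm2 x)) as [Hle|Hlt]; [now apply Hone|].
  rewrite Rabs_minus_sym.
  replace (norm2 (vsub x y)) with (norm2 (vsub y x))
    by (unfold norm2, vsub; simpl; f_equal; ring).
  apply Hone; lra.
Qed.

(** * The stream function and its gradient *)

(* Near the origin [kappa] is the stream function [x y / |z|^(1/2)], which is
   homogeneous of degree 3/2 and vanishes on the axis. *)
Definition kappa (z : pt) : R :=
  fst z * snd z / sqrt (norm2 z) * (cutoff z * cutoff z).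

(* [d_1 kappa], written with [z / |z|]; at the origin it is [0]. *)
Definition angular_part (z : pt) : R :=
  let c := fst z / norm2 z in
  let s := snd z / norm2 z in
  (s - / 2 * (c * c * s)) * (cutoff z * cutoff z)
  - 4 * (c * c * s) * (64 * cutoff z - cutoff z * cutoff z).

Definition kappa1 (z : pt) : R := sqrt (norm2 z) * angular_part z.

Definition kappa2 (z : pt) : R := kappa1 (flip z).

Lemma degree0_angular_part : degree0 angular_part.
Proof.
  assert (Hc := degree0_direction).
  assert (Hs : degree0 (fun z => snd z / norm2 z)).
  { destruct (degree0_flip _ Hc) as [C [HC [H1 H2]]].
    exists C. split; [exact HC|]. split.
    - intros x. generalize (H1 x). now rewrite norm2_flip.
    - intros x y Hxy. generalize (H2 x y Hxy). now rewrite !norm2_flip. }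
  assert (Hw := degree0_cutoff).
  unfold angular_part.
  repeat first [exact Hc | exact Hs | exact Hw | apply degree0_const
    | apply (degree0_minus (fun z => _) (fun z => _))
    | apply (degree0_mult (fun z => _) (fun z => _))].
Qed.

Lemma kappa1_holder :
  exists C, 0 <= C /\ forall x y,
    Rabs (kappa1 x - kappa1 y) <= C * sqrt (norm2 (vsub x y)).
Proof. apply sqrt_norm2_mult_holder, degree0_angular_part. Qed.

Lemma kappa2_holder :
  exists C, 0 <= C /\ forall x y,
    Rabs (kappa2 x - kappa2 y) <= C * sqrt (norm2 (vsub x y)).
Proof.
  destruct kappa1_holder as [C [HC Hk]]. exists C. split; [exact HC|].
  intros x y. rewrite <- (norm2_flip (vsub x y)). apply (Hk (flip x) (flip y)).
Qed.

Lemma derivable_square_pos_part (z : R) :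
  derivable_pt_lim (fun z => Rmax 0 z * Rmax 0 z) z (2 * Rmax 0 z).
Proof.
  intros eps Heps. exists (mkposreal eps Heps). intros h Hh Hlt. simpl in Hlt.
  (* The derivative [2 * Rmax 0 z] has Lipschitz constant 2, so the Taylor remainder is at most
     [h^2], also across the kink. *)
  assert (Hq : Rabs (Rmax 0 (z + h) * Rmax 0 (z + h) - Rmax 0 z * Rmax 0 z
                     - h * (2 * Rmax 0 z)) <= Rabs h * Rabs h).
  { rewrite <- Rabs_mult, (Rabs_pos_eq (h * h)) by nra.
    apply Rabs_le_between. unfold Rmax. repeat destruct Rle_dec; nra. }
  replace ((Rmax 0 (z + h) * Rmax 0 (z + h) - Rmax 0 z * Rmax 0 z) / h - 2 * Rmax 0 z)
    with ((Rmax 0 (z + h) * Rmax 0 (z + h) - Rmax 0 z * Rmax 0 z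
           - h * (2 * Rmax 0 z)) / h) by (field; exact Hh).
  unfold Rdiv. rewrite Rabs_mult, Rabs_inv.
  apply Rle_lt_trans with (2 := Hlt).
  assert (Hp := Rabs_pos_lt h Hh).
  apply (Rmult_le_reg_r (Rabs h)); [exact Hp|].
  rewrite Rmult_assoc, Rinv_l, Rmult_1_r by lra. exact Hq.
Qed.

Lemma kappa_flip (z : pt) : kappa (flip z) = kappa z.
Proof.
  unfold kappa. rewrite norm2_flip, cutoff_flip. unfold flip; simpl.
  now rewrite (Rmult_comm (snd z)).
Qed.

Lemma kappa_partial1 (x y : R) :
  is_derive (fun r => kappa (r, y)) x (kappa1 (x, y)).
Proof.
  destruct (Req_dec (norm2 (x, y)) 0) as [H0|H0].
  { unfold kappa1. rewrite H0, sqrt_0, Rmult_0_l.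
    assert (Hy := norm2_eq_0 _ H0). injection Hy as _ Hy. subst y.
    apply (is_derive_ext (fun _ => 0)); [|apply (is_derive_const (V := R_NormedModule))].
    intros r. unfold kappa; simpl. unfold Rdiv. ring. }
  assert (Hn : 0 < norm2 (x, y)) by (generalize (norm2_pos (x, y)); lra).
  assert (Hnn := norm2_sqr (x, y)). simpl in Hnn.
  assert (Hrho : 0 < x * x + y * y) by nra.
  assert (Hq := sqrt_lt_R0 _ Hn).
  assert (Hqq := sqrt_sqrt _ (Rlt_le _ _ Hn)).
  unfold kappa1, angular_part, cutoff, kappa; simpl.
  set (w := Rmax 0 (64 - (x * x + y * y))).
  assert (Hw : w * (64 - (x * x + y * y)) = w * w).
  { unfold w, Rmax. destruct Rle_dec; ring. }
  assert (H1 : is_derive (fun r => r * y / sqrt (norm2 (r, y))) x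
    (y / sqrt (norm2 (x, y)) - / 2 * (x * x * y)
       / (norm2 (x, y) * norm2 (x, y) * sqrt (norm2 (x, y))))).
  { unfold norm2 in *; simpl in *. auto_derive.
    - repeat split; lra.
    - set (n := sqrt (x * x + y * y)) in *. set (q := sqrt n) in *.
      rewrite <- Hqq. field. lra. }
  assert (H2 : is_derive (fun r => Rmax 0 (64 - (r * r + y * y)) * Rmax 0 (64 - (r * r + y * y))) x
    (- 2 * x * (2 * w))).
  { apply (is_derive_comp (fun z => Rmax 0 z * Rmax 0 z) (fun r => 64 - (r * r + y * y))).
    - apply is_derive_Reals. apply derivable_square_pos_part.
    - auto_derive; [exact I | ring]. }
  assert (H3 := is_derive_mult _ _ _ _ _ H1 H2 Rmult_comm).
  unfold plus, mult in H3; simpl in H3. fold w in H3.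
  match type of H3 with is_derive _ _ ?l => match goal with |- is_derive _ _ ?l' =>
    replace l' with l; [exact H3|] end end.
  (* Differentiating the cutoff produces the factor [|z|^2 * w]. Since [w * (64 - |z|^2) = w^2], it
     is a polynomial in the cutoff, and so satisfies [degree0] by closure under products and
     differences. *)
  assert (Hwr : 64 * w - w * w = w * (norm2 (x, y) * norm2 (x, y))) by (rewrite Hnn; nra).
  rewrite Hwr. set (n := norm2 (x, y)) in *. set (q := sqrt n) in *.
  rewrite <- Hqq. field. lra.
Qed.

Lemma kappa_partials : is_partials kappa kappa1 kappa2.
Proof.
  intros x y. split; apply is_derive_Reals; [apply kappa_partial1|].
  apply (is_derive_ext (fun r => kappa (r, x))).
  - intros r. apply (kappa_flip (x, r)).
  - apply kappa_partial1.
Qed.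

Lemma continuous2_of_holder (f : pt -> R) (C : R) :
  0 <= C ->
  (forall x y, Rabs (f x - f y) <= C * sqrt (norm2 (vsub x y))) -> continuous2 f.
Proof.
  intros HC Hf x eps Heps.
  assert (Hd : 0 < eps / (C + 1)) by (apply Rdiv_lt_0_compat; lra).
  exists (eps / (C + 1) * (eps / (C + 1))). split; [nra|].
  intros y Hy. eapply Rle_lt_trans; [apply Hf|].
  assert (Hs : sqrt (norm2 (vsub y x)) <= eps / (C + 1)).
  { rewrite <- (sqrt_square (eps / (C + 1))) by lra. apply sqrt_le_1_alt; lra. }
  replace eps with ((C + 1) * (eps / (C + 1))) by (field; lra). nra.
Qed.

Lemma kappa_C11half_c : C11half_c kappa kappa1 kappa2.
Proof.
  destruct kappa1_holder as [C1 [HC1 H1]]. destruct kappa2_holder as [C2 [HC2 H2]].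
  split; [exact kappa_partials|].
  split; [now apply (continuous2_of_holder _ C1)|].
  split; [now apply (continuous2_of_holder _ C2)|].
  split.
  - exists (C1 + C2). split; [lra|]. intros x y.
    eapply Rle_trans; [apply norm2_le_abs|].
    generalize (H1 x y) (H2 x y). lra.
  - exists 8. split; [lra|]. intros z Hz. unfold kappa.
    rewrite cutoff_norm2, Rmax_left by nra. ring.
Qed.

(** * The kernel on the axis *)

Lemma kappa1_axis (x : R) : kappa1 (x, 0) = 0.
Proof. unfold kappa1, angular_part; simpl. unfold Rdiv. ring. Qed.

Lemma kappa2_axis (x : R) :
  0 <= x -> kappa2 (x, 0) = sqrt x * (Rmax 0 (64 - x * x) * Rmax 0 (64 - x * x)).
Proof.
  intros Hx. unfold kappa2, kappa1, angular_part. rewrite norm2_flip, cutoff_flip.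
  unfold flip, cutoff; simpl. rewrite norm2_axis, Rabs_pos_eq by assumption.
  rewrite Rmult_0_l, Rplus_0_r.
  destruct Hx as [Hx|Hx]; [field; lra|].
  subst x. rewrite sqrt_0. ring.
Qed.

Lemma kappa2_axis_opp (x : R) : kappa2 (- x, 0) = - kappa2 (x, 0).
Proof.
  unfold kappa2, kappa1, angular_part. rewrite !norm2_flip, !cutoff_flip.
  unfold flip, cutoff; simpl. rewrite !norm2_axis, Rabs_Ropp.
  replace (- x * - x) with (x * x) by ring. unfold Rdiv. ring.
Qed.

(** With [q = sqrt x] the value is [4096 q - 128 q^5 + q^9]. The last term increases, and the linear
    one outweighs the middle one because [128 * 20 < 4096]. *)
Lemma kappa2_axis_monotone_pos (x y : R) :
  0 <= x -> x <= y -> y <= 2 -> kappa2 (x, 0) <= kappa2 (y, 0).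
Proof.
  intros Hx Hxy Hy. rewrite !kappa2_axis, !Rmax_right by nra.
  assert (Hp := sqrt_pos x). assert (Hq := sqrt_pos y). assert (Hpq := sqrt_le_1_alt _ _ Hxy).
  assert (Hpp := sqrt_sqrt x Hx). assert (Hqq := sqrt_sqrt y ltac:(lra)).
  set (p := sqrt x) in *. set (q := sqrt y) in *.
  assert (Hx2 : x * x <= y * y) by nra. assert (Hy4 : y * y <= 4) by nra.
  assert (Hxy4 : x * y <= y * y) by nra.
  assert (Hpq4 : p * q <= y).
  { rewrite <- Hqq. now apply Rmult_le_compat_r. }
  assert (Hpq0 : 0 <= p * q) by now apply Rmult_le_pos.
  (* [q^5 - p^5 <= 20 (q - p)] with [q^4 <= 4], against the linear term [4096 (q - p)]. *)
  assert (H5 : q * (y * y) - p * (x * x) <= 20 * (q - p)).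
  { replace (q * (y * y) - p * (x * x))
      with ((q - p) * (y * y + p * q * y + x * y + p * q * x + x * x))
      by (rewrite <- Hpp, <- Hqq; ring).
    rewrite (Rmult_comm 20). apply Rmult_le_compat_l; [lra|].
    assert (p * q * y <= y * y) by nra. assert (p * q * x <= y * y) by nra. lra. }
  assert (H9 : p * (x * x * (x * x)) <= q * (y * y * (y * y))).
  { apply Rmult_le_compat; nra. }
  lra.
Qed.

Lemma kappa2_axis_monotone (x y : R) :
  -2 <= x -> x <= y -> y <= 2 -> kappa2 (x, 0) <= kappa2 (y, 0).
Proof.
  intros Hx Hxy Hy.
  assert (H0 : kappa2 (0, 0) = 0) by (rewrite kappa2_axis by lra; rewrite sqrt_0; ring).
  destruct (Rle_lt_dec 0 x) as [Hx0|Hx0]; [now apply kappa2_axis_monotone_pos|].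
  assert (Hnx := kappa2_axis_opp (- x)). rewrite Ropp_involutive in Hnx.
  destruct (Rle_lt_dec 0 y) as [Hy0|Hy0].
  - generalize (kappa2_axis_monotone_pos 0 y ltac:(lra) Hy0 Hy)
      (kappa2_axis_monotone_pos 0 (- x) ltac:(lra) ltac:(lra) ltac:(lra)). lra.
  - assert (Hny := kappa2_axis_opp (- y)). rewrite Ropp_involutive in Hny.
    generalize (kappa2_axis_monotone_pos (- y) (- x) ltac:(lra) ltac:(lra) ltac:(lra)). lra.
Qed.

(** The factor 2 is far from sharp; it pays for the truncation in [axis_force_attracts], where
    distances up to 4 are clamped to 2. *)
Lemma kappa2_axis_lower (x : R) : 0 <= x <= 2 -> 2 * sqrt x <= kappa2 (x, 0).
Proof.
  intros [Hx Hx2]. rewrite kappa2_axis, Rmax_right by nra.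
  assert (Hw : 60 <= 64 - x * x) by nra.
  set (w := 64 - x * x) in *. rewrite (Rmult_comm 2).
  apply Rmult_le_compat_l; [apply sqrt_pos | nra].
Qed.

(** * The dissipative equation on the axis *)

Lemma continuity_of_holder (g Y : R -> R) (C : R) :
  0 < C -> continuity Y ->
  (forall s s', Rabs (g s - g s') <= C * sqrt (Rabs (Y s - Y s'))) ->
  continuity g.
Proof.
  intros HC HY Hg s eps Heps.
  assert (Hd : 0 < eps / C) by now apply Rdiv_lt_0_compat.
  destruct (HY s ((eps / C) * (eps / C))) as [a [Ha Hlim]].
  { now apply Rmult_lt_0_compat. }
  exists a; split; [exact Ha|].
  intros s' Hs'. specialize (Hlim s' Hs').
  simpl in *. unfold R_dist in *.
  apply Rle_lt_trans with (1 := Hg s' s).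
  assert (Hq : sqrt (Rabs (Y s' - Y s)) < eps / C).
  { rewrite <- (sqrt_square (eps / C)) by lra.
    apply sqrt_lt_1_alt; split; [apply Rabs_pos | exact Hlim]. }
  apply Rlt_le_trans with (C * (eps / C)); [|right; field; lra].
  now apply Rmult_lt_compat_l.
Qed.

Lemma ex_RInt_continuity (f : R -> R) (a b : R) : continuity f -> ex_RInt f a b.
Proof.
  intros Hf. apply (ex_RInt_continuous (V := R_CompleteNormedModule)).
  intros z _. apply continuity_pt_filterlim, Hf.
Qed.

Lemma sqrt_small (eps : R) : 0 < eps -> exists d, 0 < d /\ forall x, x <= d -> sqrt x <= eps.
Proof.
  intros He. exists (eps * eps). split; [now apply Rmult_lt_0_compat|].
  intros x Hx. rewrite <- (sqrt_square eps) by lra. now apply sqrt_le_1_alt.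
Qed.

(** * Truncation, geometric limits, time grids and reflection of integrals *)

Definition clamp (m x : R) : R := Rmax (- m) (Rmin m x).

Lemma clamp_range (m x : R) : 0 <= m -> - m <= clamp m x <= m.
Proof. intros Hm; unfold clamp, Rmax, Rmin; repeat destruct Rle_dec; lra. Qed.

Lemma clamp_id (m x : R) : - m <= x <= m -> clamp m x = x.
Proof. intros Hm; unfold clamp, Rmax, Rmin; repeat destruct Rle_dec; lra. Qed.

Lemma clamp_opp (m x : R) : 0 <= m -> clamp m (- x) = - clamp m x.
Proof. intros Hm; unfold clamp, Rmax, Rmin; repeat destruct Rle_dec; lra. Qed.

Lemma clamp_le (m x y : R) : x <= y -> clamp m x <= clamp m y.
Proof. intros Hm; unfold clamp, Rmax, Rmin; repeat destruct Rle_dec; lra. Qed.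

Lemma clamp_lipschitz (m x y : R) : 0 <= m -> Rabs (clamp m x - clamp m y) <= Rabs (x - y).
Proof.
  intros Hm; unfold clamp, Rmax, Rmin, Rabs.
  repeat destruct Rle_dec; repeat destruct Rcase_abs; lra.
Qed.

Lemma inI_clamp (s : R) : inI (clamp 1 s).
Proof. unfold inI. apply (clamp_range 1 s). lra. Qed.

Lemma geometric_limit (u : nat -> R) (C : R) :
  (forall k, Rabs (u (S k) - u k) <= C * (/ 2) ^ k) ->
  exists l : R, is_lim_seq u l /\ forall k, Rabs (u k - l) <= 2 * C * (/ 2) ^ k.
Proof.
  intros Hu.
  assert (HC : 0 <= C).
  { generalize (Hu O) (Rabs_pos (u 1%nat - u O)); simpl; lra. }
  assert (Hgap : forall k n, Rabs (u (n + k)%nat - u k) <= 2 * C * (/ 2) ^ k).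
  { intros k n.
    assert (Hn : Rabs (u (n + k)%nat - u k) <= 2 * C * ((/ 2) ^ k - (/ 2) ^ (n + k))).
    { induction n as [|n IH].
      - simpl. rewrite Rminus_diag, Rabs_R0. lra.
      - replace (u (S n + k)%nat - u k)
          with ((u (S (n + k)) - u (n + k)%nat) + (u (n + k)%nat - u k))
          by (simpl; ring).
        eapply Rle_trans; [apply Rabs_triang|].
        specialize (Hu (n + k)%nat). simpl pow. lra. }
    assert (0 <= (/ 2) ^ (n + k)) by (apply pow_le; lra).
    nra. }
  assert (Hex : ex_finite_lim_seq u).
  { apply ex_lim_seq_cauchy_corr. intros eps.
    assert (Hlim : is_lim_seq (fun k => 4 * C * (/ 2) ^ k) 0).
    { replace (Finite 0) with (Rbar_mult (4 * C) 0) by (simpl; f_equal; ring).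
      apply is_lim_seq_scal_l, is_lim_seq_geom.
      rewrite Rabs_pos_eq; lra. }
    destruct (proj1 (is_lim_seq_Reals _ _) Hlim eps (cond_pos eps)) as [N HN].
    exists N. intros n m Hn Hm.
    specialize (HN N (le_n N)). unfold R_dist in HN.
    rewrite Rminus_0_r in HN. apply Rabs_def2 in HN.
    generalize (Hgap N (n - N)%nat) (Hgap N (m - N)%nat).
    replace (n - N + N)%nat with n by lia.
    replace (m - N + N)%nat with m by lia.
    intros H1 H2. apply Rabs_le_between in H1, H2.
    apply Rabs_def1; lra. }
  destruct Hex as [l Hl]. exists l. split; [exact Hl|]. intros k.
  assert (Hl' : is_lim_seq (fun n => Rabs (u (n + k)%nat - u k)) (Rabs (l - u k))).
  { apply (is_lim_seq_abs _ (Finite (l - u k))).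
    apply is_lim_seq_minus'; [|apply is_lim_seq_const].
    now apply -> is_lim_seq_incr_n. }
  rewrite Rabs_minus_sym.
  exact (is_lim_seq_le _ _ _ _ (Hgap k) Hl' (is_lim_seq_const _)).
Qed.

Lemma limit_of_dist (u e : nat -> R) (l : R) :
  (forall k, Rabs (u k - l) <= e k) -> is_lim_seq e 0 -> is_lim_seq u l.
Proof.
  intros Hu He.
  apply (is_lim_seq_le_le (fun k => l - e k) u (fun k => l + e k)).
  - intros k. specialize (Hu k). apply Rabs_le_between in Hu. lra.
  - replace l with (l - 0) at 1 by ring.
    apply is_lim_seq_minus'; [apply is_lim_seq_const | exact He].
  - replace l with (l + 0) at 1 by ring.
    apply is_lim_seq_plus'; [apply is_lim_seq_const | exact He].
Qed.

Lemma half_pow_limit (c : R) : is_lim_seq (fun k => c * (/ 2) ^ k) 0.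
Proof.
  replace (Finite 0) with (Rbar_mult c 0) by (simpl; f_equal; ring).
  apply is_lim_seq_scal_l, is_lim_seq_geom. rewrite Rabs_pos_eq; lra.
Qed.

Lemma pow_quarter (k : nat) : (/ 4) ^ k = (/ 2) ^ k * (/ 2) ^ k.
Proof. rewrite <- Rpow_mult_distr. f_equal. field. Qed.

Definition floor_nat (x : R) : nat := Z.to_nat (Int_part x).

Lemma floor_nat_spec (x : R) : 0 <= x -> INR (floor_nat x) <= x < INR (floor_nat x) + 1.
Proof.
  intros Hx. unfold floor_nat. destruct (base_Int_part x) as [H1 H2].
  assert (Hz : (0 <= Int_part x)%Z).
  { apply Z.lt_succ_r, lt_IZR. rewrite succ_IZR. lra. }
  rewrite INR_IZR_INZ, Z2Nat.id by exact Hz. lra.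
Qed.

Lemma floor_nat_le (x y : R) : 0 <= x -> x <= y -> (floor_nat x <= floor_nat y)%nat.
Proof.
  intros Hx Hy. apply Nat.lt_succ_r, INR_lt. rewrite S_INR.
  generalize (floor_nat_spec x Hx) (floor_nat_spec y ltac:(lra)). lra.
Qed.

Lemma scaled_floor_le (k : nat) (t : R) :
  0 <= t -> INR (floor_nat (t * 4 ^ k)) * (/ 4) ^ k <= t.
Proof.
  intros Ht. assert (H4 : 0 < 4 ^ k) by (apply pow_lt; lra).
  rewrite pow_inv. apply (Rmult_le_reg_r (4 ^ k)); [exact H4|].
  rewrite Rmult_assoc, Rinv_l, Rmult_1_r by lra. apply floor_nat_spec. nra.
Qed.

Lemma scaled_floor_gt (k : nat) (t : R) :
  0 <= t -> t - (/ 4) ^ k < INR (floor_nat (t * 4 ^ k)) * (/ 4) ^ k.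
Proof.
  intros Ht. assert (H4 : 0 < 4 ^ k) by (apply pow_lt; lra).
  rewrite pow_inv. apply (Rmult_lt_reg_r (4 ^ k)); [exact H4|].
  rewrite Rmult_minus_distr_r, Rmult_assoc, Rinv_l, Rmult_1_r by lra.
  generalize (floor_nat_spec (t * 4 ^ k) ltac:(nra)). lra.
Qed.

Lemma RInt_reflect (f : R -> R) :
  continuity f -> RInt (fun a => opp (f (- a))) (-1) 1 = - RInt f (-1) 1.
Proof.
  intros Hf. apply is_RInt_unique.
  apply (is_RInt_comp_opp (V := R_NormedModule) f).
  replace (- -1) with 1 by ring.
  apply (is_RInt_swap (V := R_NormedModule)).
  apply (RInt_correct (V := R_CompleteNormedModule)).
  now apply ex_RInt_continuity.
Qed.

Lemma RInt_odd (f : R -> R) :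
  continuity f -> (forall a, f (- a) = - f a) -> RInt f (-1) 1 = 0.
Proof.
  intros Hf Hodd. generalize (RInt_reflect f Hf).
  rewrite (RInt_ext _ f); [lra|].
  intros a _. rewrite Hodd. apply Ropp_involutive.
Qed.

(** * The nonlocal drift and its dissipativity *)

Section Flow.

Variables (F : R -> R) (H B : R).
Hypothesis H_pos : 0 < H.
Hypothesis B_pos : 0 < B.
Hypothesis F_odd : forall x, F (- x) = - F x.
Hypothesis F_antitone : forall x y, x <= y -> F y <= F x.
Hypothesis F_holder : forall x y, Rabs (F x - F y) <= H * sqrt (Rabs (x - y)).
Hypothesis F_bound : forall x, Rabs (F x) <= B.

Definition drift (Y : R -> R) (s : R) : R := RInt (fun a => F (Y s - Y a)) (-1) 1.

Lemma integrand_continuity (Y : R -> R) (s : R) :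
  continuity Y -> continuity (fun a => F (Y s - Y a)).
Proof.
  intros HY. apply (continuity_of_holder _ Y H); auto.
  intros a a'. eapply Rle_trans; [apply F_holder|].
  right; f_equal; f_equal. rewrite Rabs_minus_sym. f_equal; ring.
Qed.

Lemma integrand_ex_RInt (Y : R -> R) (s : R) :
  continuity Y -> ex_RInt (fun a => F (Y s - Y a)) (-1) 1.
Proof. intros HY. now apply ex_RInt_continuity, integrand_continuity. Qed.

Lemma drift_bound (Y : R -> R) (s : R) : continuity Y -> Rabs (drift Y s) <= 2 * B.
Proof.
  intros HY. replace (2 * B) with ((1 - -1) * B) by ring.
  apply abs_RInt_le_const; [lra | now apply integrand_ex_RInt | intros; apply F_bound].
Qed.

(** The one comparison behind antitonicity, Hoelder dependence and dissipativity of the drift, which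
    is why both the configuration and the particle may differ. The factor 2 is the length of the
    segment. *)
Lemma drift_le (Y Z : R -> R) (s s' e : R) :
  continuity Y -> continuity Z ->
  (forall a, inI a -> F (Y s - Y a) <= F (Z s' - Z a) + e) ->
  drift Y s <= drift Z s' + 2 * e.
Proof.
  intros HY HZ Hle. unfold drift.
  replace (2 * e) with (RInt (fun _ : R => e) (-1) 1)
    by (rewrite RInt_const; unfold scal; simpl; unfold mult; simpl; ring).
  rewrite <- (RInt_plus (V := R_CompleteNormedModule)
                (fun a => F (Z s' - Z a)) (fun _ => e));
    [| now apply integrand_ex_RInt | apply ex_RInt_const].
  apply RInt_le; [lra | now apply integrand_ex_RInt | |].
  - apply (ex_RInt_plus (V := R_NormedModule));
      [now apply integrand_ex_RInt | apply ex_RInt_const].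
  - intros a Ha. apply Hle. unfold inI; lra.
Qed.

Lemma drift_antitone (Y : R -> R) (s s' : R) :
  continuity Y -> Y s' <= Y s -> drift Y s <= drift Y s'.
Proof.
  intros HY Hs. replace (drift Y s') with (drift Y s' + 2 * 0) by ring.
  apply drift_le; auto. intros a _. rewrite Rplus_0_r. apply F_antitone; lra.
Qed.

Lemma F_near (x y d : R) : Rabs (x - y) <= d -> F x <= F y + H * sqrt d.
Proof.
  intros Hd. generalize (F_holder x y) (Rle_abs (F x - F y)).
  assert (sqrt (Rabs (x - y)) <= sqrt d) by now apply sqrt_le_1_alt.
  nra.
Qed.

(** Modulus of continuity of the drift in the sup norm: the outer 2 is the length of the segment,
    the inner 2 arises because both [Y s] and [Y a] are perturbed. *)
Definition modulus (d : R) : R := 2 * (H * sqrt (2 * d)).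

Lemma modulus_le (d d' : R) : d <= d' -> modulus d <= modulus d'.
Proof.
  intros Hd. unfold modulus.
  assert (sqrt (2 * d) <= sqrt (2 * d')) by (apply sqrt_le_1_alt; lra).
  nra.
Qed.

Lemma modulus_pos (d : R) : 0 <= modulus d.
Proof. unfold modulus. generalize (sqrt_pos (2 * d)). nra. Qed.

Lemma modulus_small (eps : R) :
  0 < eps -> exists d, 0 < d /\ forall x, x <= d -> modulus x <= eps.
Proof.
  intros He. destruct (sqrt_small (eps / (2 * H))) as [d [Hd Hs]].
  { apply Rdiv_lt_0_compat; lra. }
  exists (d / 2). split; [lra|]. intros x Hx. unfold modulus.
  assert (Hq := Hs (2 * x) ltac:(lra)).
  replace eps with (2 * (H * (eps / (2 * H)))) by (field; lra). nra.
Qed.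

Lemma drift_holder (Y Z : R -> R) (s d : R) :
  continuity Y -> continuity Z -> inI s ->
  (forall a, inI a -> Rabs (Y a - Z a) <= d) ->
  Rabs (drift Y s - drift Z s) <= modulus d.
Proof.
  intros HY HZ Hs Hd. unfold modulus.
  assert (Hdiff : forall a, inI a -> Rabs ((Y s - Y a) - (Z s - Z a)) <= 2 * d).
  { intros a Ha. generalize (Hd a Ha) (Hd s Hs). intros H1 H2.
    apply Rabs_le_between in H1, H2. apply Rabs_le_between. lra. }
  apply Rabs_le_between; split.
  - enough (drift Z s <= drift Y s + 2 * (H * sqrt (2 * d))) by lra.
    apply drift_le; auto. intros a Ha. apply F_near.
    rewrite Rabs_minus_sym. now apply Hdiff.
  - enough (drift Y s <= drift Z s + 2 * (H * sqrt (2 * d))) by lra.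
    apply drift_le; auto. intros a Ha. now apply F_near, Hdiff.
Qed.

Lemma drift_continuity (Y : R -> R) : continuity Y -> continuity (drift Y).
Proof.
  intros HY. apply (continuity_of_holder _ Y (2 * H)); [lra | assumption |].
  intros s s'.
  assert (Hone : forall p q, drift Y p <= drift Y q + 2 * (H * sqrt (Rabs (Y p - Y q)))).
  { intros p q. apply drift_le; auto. intros a _. apply F_near.
    right; f_equal; ring. }
  generalize (Hone s s') (Hone s' s).
  rewrite (Rabs_minus_sym (Y s') (Y s)). intros H1 H2.
  apply Rabs_le_between. lra.
Qed.

(* Dissipativity: where [Y' - Z'] is maximal, [drift Y' <= drift Z'], because [F] is
   antitone; so an approximate backward Euler step does not expand distances. *)
Lemma backward_step_le (Y Y' Z Z' : R -> R) (tau e d : R) :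
  continuity Y' -> continuity Z' -> 0 <= tau ->
  (forall s, inI s -> Rabs (Y' s - Y s - tau * drift Y' s) <= e) ->
  (forall s, inI s -> Rabs (Z' s - Z s - tau * drift Z' s) <= e) ->
  (forall s, inI s -> Rabs (Y s - Z s) <= d) ->
  forall s, inI s -> Y' s - Z' s <= d + 2 * e.
Proof.
  intros HY HZ Htau HYY HZZ Hd s Hs.
  destruct (continuity_ab_maj (fun s => Y' s - Z' s) (-1) 1) as [m [Hmax Hm]].
  { lra. }
  { intros c _. apply continuity_pt_minus; [apply HY | apply HZ]. }
  assert (HU : drift Y' m <= drift Z' m).
  { replace (drift Z' m) with (drift Z' m + 2 * 0) by ring.
    apply drift_le; auto. intros a Ha. rewrite Rplus_0_r. apply F_antitone.
    specialize (Hmax a Ha). simpl in Hmax. lra. }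
  specialize (Hmax s Hs). simpl in Hmax.
  specialize (HYY m Hm). specialize (HZZ m Hm). specialize (Hd m Hm).
  apply Rabs_le_between in HYY, HZZ, Hd.
  nra.
Qed.

Lemma backward_step_dist (Y Y' Z Z' : R -> R) (tau e d : R) :
  continuity Y' -> continuity Z' -> 0 <= tau ->
  (forall s, inI s -> Rabs (Y' s - Y s - tau * drift Y' s) <= e) ->
  (forall s, inI s -> Rabs (Z' s - Z s - tau * drift Z' s) <= e) ->
  (forall s, inI s -> Rabs (Y s - Z s) <= d) ->
  forall s, inI s -> Rabs (Y' s - Z' s) <= d + 2 * e.
Proof.
  intros HY HZ Htau HYY HZZ Hd s Hs. apply Rabs_le_between; split.
  - enough (Z' s - Y' s <= d + 2 * e) by lra.
    apply (backward_step_le Z Z' Y Y' tau); auto.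
    intros a Ha. rewrite Rabs_minus_sym. auto.
  - now apply (backward_step_le Y Y' Z Z' tau).
Qed.

(** * Explicit Euler schemes *)

Fixpoint euler (h : R) (n : nat) : R -> R :=
  match n with
  | O => fun s => s
  | S n => fun s => euler h n s + h * drift (euler h n) s
  end.

Lemma euler_continuity (h : R) (n : nat) : continuity (euler h n).
Proof.
  induction n as [|n IH]; simpl.
  - apply derivable_continuous, derivable_id.
  - apply (continuity_plus (euler h n) (fun s => h * drift (euler h n) s)); auto.
    apply (continuity_scal (drift (euler h n)) h). now apply drift_continuity.
Qed.

Lemma euler_speed (h : R) (n m : nat) (s : R) :
  0 <= h -> Rabs (euler h (n + m) s - euler h n s) <= 2 * B * (INR m * h).
Proof.
  intros Hh. induction m as [|m IH].
  - rewrite Nat.add_0_r, Rminus_diag, Rabs_R0. simpl. lra.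
  - rewrite Nat.add_succ_r, S_INR. simpl euler.
    replace (euler h (n + m) s + h * drift (euler h (n + m)) s - euler h n s)
      with ((euler h (n + m) s - euler h n s) + h * drift (euler h (n + m)) s) by ring.
    eapply Rle_trans; [apply Rabs_triang|].
    rewrite (Rabs_mult h), (Rabs_pos_eq h) by assumption.
    generalize (drift_bound (euler h (n + m)) s (euler_continuity _ _)). nra.
Qed.

(** The drift is frozen at a reference configuration [Z]. Taking for [Z] the first iterate gives a
    forward estimate; taking the last one exhibits [m] explicit steps as one approximate implicit
    step. *)
Lemma euler_increment (h d : R) (n m : nat) (Z : R -> R) (s : R) :
  0 <= h -> continuity Z -> inI s ->
  (forall j a, (j < m)%nat -> inI a -> Rabs (euler h (n + j) a - Z a) <= d) ->
  Rabs (euler h (n + m) s - euler h n s - INR m * h * drift Z s)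
    <= INR m * h * modulus d.
Proof.
  intros Hh HZ Hs. induction m as [|m IH]; intros Hd.
  - rewrite Nat.add_0_r. simpl. rewrite !Rmult_0_l, Rminus_diag, Rminus_0_r, Rabs_R0. lra.
  - rewrite Nat.add_succ_r, S_INR. simpl euler.
    replace (euler h (n + m) s + h * drift (euler h (n + m)) s - euler h n s
             - (INR m + 1) * h * drift Z s)
      with ((euler h (n + m) s - euler h n s - INR m * h * drift Z s)
            + h * (drift (euler h (n + m)) s - drift Z s)) by ring.
    eapply Rle_trans; [apply Rabs_triang|].
    rewrite (Rabs_mult h), (Rabs_pos_eq h) by assumption.
    assert (HU : Rabs (drift (euler h (n + m)) s - drift Z s) <= modulus d).
    { apply drift_holder; [apply euler_continuity | assumption | assumption |].
      intros a Ha. apply Hd; [lia | assumption]. }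
    assert (Hm := IH (fun j a Hj => Hd j a (Nat.lt_lt_succ_r _ _ Hj))).
    nra.
Qed.

Lemma euler_increment_forward (h : R) (n m : nat) (s : R) :
  0 <= h -> inI s ->
  Rabs (euler h (n + m) s - euler h n s - INR m * h * drift (euler h n) s)
    <= INR m * h * modulus (2 * B * (INR m * h)).
Proof.
  intros Hh Hs. apply euler_increment; auto; [apply euler_continuity|].
  intros j a Hj _. eapply Rle_trans; [now apply euler_speed|].
  apply Rmult_le_compat_l; [lra|]. apply Rmult_le_compat_r; [assumption|].
  apply le_INR; lia.
Qed.

Lemma euler_increment_backward (h : R) (n m : nat) (s : R) :
  0 <= h -> inI s ->
  Rabs (euler h (n + m) s - euler h n s - INR m * h * drift (euler h (n + m)) s)
    <= INR m * h * modulus (2 * B * (INR m * h)).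
Proof.
  intros Hh Hs. apply euler_increment; auto; [apply euler_continuity|].
  intros j a Hj _. rewrite Rabs_minus_sym.
  replace (n + m)%nat with ((n + j) + (m - j))%nat by lia.
  eapply Rle_trans; [now apply euler_speed|].
  apply Rmult_le_compat_l; [lra|]. apply Rmult_le_compat_r; [assumption|].
  apply le_INR; lia.
Qed.

(** One coarse step and four fine steps are both approximate implicit steps of length [h] with the
    same error bound. Each coarse step therefore adds at most twice this error and leaves the
    earlier distance unamplified. *)
Lemma euler_refine (h : R) (n : nat) (s : R) :
  0 <= h -> inI s ->
  Rabs (euler h n s - euler (h / 4) (4 * n) s)
    <= INR n * (2 * (h * modulus (2 * B * h))).
Proof.
  intros Hh Hs. revert s Hs. induction n as [|n IH]; intros s Hs.
  - simpl. rewrite Rminus_diag, Rabs_R0. lra.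
  - rewrite S_INR, Rmult_plus_distr_r, Rmult_1_l.
    apply (backward_step_dist (euler h n) (euler h (S n))
             (euler (h / 4) (4 * n)) (euler (h / 4) (4 * S n)) h);
      try apply euler_continuity; auto.
    + intros a Ha. generalize (euler_increment_backward h n 1 a Hh Ha).
      rewrite Nat.add_1_r. simpl INR. now rewrite !Rmult_1_l.
    + intros a Ha.
      generalize (euler_increment_backward (h / 4) (4 * n) 4 a ltac:(lra) Ha).
      replace (4 * n + 4)%nat with (4 * S n)%nat by lia.
      now replace (INR 4 * (h / 4)) with h by (simpl; field).
Qed.

(** Either the left side is nonpositive, or the drift at the new positions pulls the two particles
    together, up to the error of the implicit step. In the limit the trajectories become 1-Lipschitz
    in the label. *)
Lemma euler_order (h : R) (n : nat) (s s' : R) :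
  0 <= h -> inI s -> inI s' ->
  euler h n s - euler h n s' <= Rabs (s - s') + INR n * (2 * (h * modulus (2 * B * h))).
Proof.
  intros Hh Hs Hs'. induction n as [|n IH].
  - simpl. rewrite Rmult_0_l, Rplus_0_r. apply Rle_abs.
  - assert (Hpos : 0 <= h * modulus (2 * B * h))
      by (apply Rmult_le_pos; [assumption | apply modulus_pos]).
    destruct (Rle_lt_dec (euler h (S n) s) (euler h (S n) s')) as [Hle|Hlt].
    { generalize (Rabs_pos (s - s')) (pos_INR (S n)). nra. }
    assert (HU := drift_antitone _ s s' (euler_continuity h (S n)) (Rlt_le _ _ Hlt)).
    generalize (euler_increment_backward h n 1 s Hh Hs)
      (euler_increment_backward h n 1 s' Hh Hs').
    rewrite Nat.add_1_r, (S_INR n), INR_1, !Rmult_1_l.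
    intros H1 H2. apply Rabs_le_between in H1, H2. nra.
Qed.

(** * Odd symmetry and the limit of the schemes *)

Lemma drift_opp (Y : R -> R) (s : R) :
  continuity Y -> (forall a, Y (- a) = - Y a) -> drift Y (- s) = - drift Y s.
Proof.
  intros HY Hodd. unfold drift. rewrite <- RInt_reflect by now apply integrand_continuity.
  apply RInt_ext. intros a _. rewrite !Hodd. unfold opp; simpl.
  rewrite <- F_odd. f_equal; ring.
Qed.

Lemma euler_opp (h : R) (n : nat) (s : R) : euler h n (- s) = - euler h n s.
Proof.
  revert s. induction n as [|n IH]; intros s; simpl; [reflexivity|].
  rewrite drift_opp, IH; [ring | apply euler_continuity | exact IH].
Qed.

(** The clamp extends the labels beyond [inI], so that the limits are continuous on the whole line,
    as the lemmas on [drift] require. *)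
Definition approx (k : nat) (t s : R) : R :=
  euler ((/ 4) ^ k) (floor_nat (t * 4 ^ k)) (clamp 1 s).

(** The first term is the refinement error accumulated up to time [t]; the second covers the at most
    three fine steps by which the finer grid time exceeds the coarser one. *)
Definition rate (t : R) : R := 2 * t * modulus (2 * B) + 2 * B.

Lemma modulus_step (k : nat) :
  modulus (2 * B * (/ 4) ^ k) = modulus (2 * B) * (/ 2) ^ k.
Proof.
  unfold modulus. rewrite pow_quarter.
  replace (2 * (2 * B * ((/ 2) ^ k * (/ 2) ^ k)))
    with (2 * (2 * B) * ((/ 2) ^ k * (/ 2) ^ k)) by ring.
  rewrite sqrt_mult_alt by lra.
  rewrite sqrt_square by (apply pow_le; lra). ring.
Qed.

Lemma euler_error_le (k n : nat) (t : R) :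
  INR n * (/ 4) ^ k <= t ->
  INR n * (2 * ((/ 4) ^ k * modulus (2 * B * (/ 4) ^ k)))
    <= 2 * t * modulus (2 * B) * (/ 2) ^ k.
Proof.
  intros Hn. rewrite modulus_step.
  assert (0 <= modulus (2 * B) * (/ 2) ^ k).
  { apply Rmult_le_pos; [apply modulus_pos | apply pow_le; lra]. }
  nra.
Qed.

Lemma approx_refine (k : nat) (t s : R) :
  0 <= t -> Rabs (approx (S k) t s - approx k t s) <= rate t * (/ 2) ^ k.
Proof.
  intros Ht. unfold approx, rate.
  assert (Hq : 0 < 4 ^ k) by (apply pow_lt; lra).
  assert (Hx : 0 <= t * 4 ^ k) by nra.
  set (n := floor_nat (t * 4 ^ k)).
  destruct (floor_nat_spec _ Hx) as [Hn1 Hn2]. fold n in Hn1, Hn2.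
  assert (H4 : t * 4 ^ S k = 4 * (t * 4 ^ k)) by (simpl; ring).
  destruct (floor_nat_spec (t * 4 ^ S k)) as [Hm1 Hm2]; [lra|].
  set (m := floor_nat (t * 4 ^ S k)) in *. rewrite H4 in Hm1, Hm2.
  assert (Hlow : (4 * n < S m)%nat).
  { apply INR_lt. rewrite S_INR, mult_INR. simpl (INR 4). lra. }
  assert (Hup : (m < 4 * n + 4)%nat).
  { apply INR_lt. rewrite plus_INR, mult_INR. simpl (INR 4). lra. }
  assert (Hh : 0 < (/ 4) ^ k) by (apply pow_lt; lra).
  assert (Hnt : INR n * (/ 4) ^ k <= t) by now apply scaled_floor_le.
  assert (Hs := inI_clamp s). set (r := clamp 1 s) in *.
  assert (H1 := euler_refine _ n r (Rlt_le _ _ Hh) Hs).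
  assert (H2 := euler_speed ((/ 4) ^ k / 4) (4 * n) (m - 4 * n) r ltac:(lra)).
  replace (4 * n + (m - 4 * n))%nat with m in H2 by lia.
  replace ((/ 4) ^ S k) with ((/ 4) ^ k / 4) by (simpl; field).
  assert (H3 := euler_error_le k n t Hnt).
  assert (Hm : INR (m - 4 * n) <= 4).
  { replace 4 with (INR 4) by (simpl; ring). apply le_INR; lia. }
  assert (Hhalf : (/ 4) ^ k <= (/ 2) ^ k) by (apply pow_incr; lra).
  assert (H5 : 2 * B * (INR (m - 4 * n) * ((/ 4) ^ k / 4)) <= 2 * B * (/ 2) ^ k).
  { apply Rmult_le_compat_l; nra. }
  rewrite Rabs_minus_sym in H1.
  replace (euler ((/ 4) ^ k / 4) m r - euler ((/ 4) ^ k) n r)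
    with ((euler ((/ 4) ^ k / 4) m r - euler ((/ 4) ^ k / 4) (4 * n) r)
          + (euler ((/ 4) ^ k / 4) (4 * n) r - euler ((/ 4) ^ k) n r)) by ring.
  eapply Rle_trans; [apply Rabs_triang|]. lra.
Qed.

Definition trajectory (t s : R) : R := real (Lim_seq (fun k => approx k t s)).

Lemma approx_limit (t s : R) :
  0 <= t ->
  is_lim_seq (fun k => approx k t s) (trajectory t s) /\
  forall k, Rabs (approx k t s - trajectory t s) <= 2 * rate t * (/ 2) ^ k.
Proof.
  intros Ht.
  destruct (geometric_limit (fun k => approx k t s) (rate t)) as [l [Hl Hk]].
  { intros k. now apply approx_refine. }
  assert (Hy : trajectory t s = l) by (unfold trajectory; now rewrite (is_lim_seq_unique _ _ Hl)).
  rewrite Hy. now split.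
Qed.

Lemma trajectory_start (s : R) : inI s -> trajectory 0 s = s.
Proof.
  intros Hs. unfold trajectory.
  rewrite (Lim_seq_ext _ (fun _ => s)); [now rewrite Lim_seq_const|].
  intros k. unfold approx, floor_nat.
  rewrite Rmult_0_l. change 0 with (INR 0). rewrite Int_part_INR. simpl.
  now apply clamp_id.
Qed.

Lemma trajectory_opp (t s : R) : trajectory t (- s) = - trajectory t s.
Proof.
  unfold trajectory. rewrite (Lim_seq_ext _ (fun k => - approx k t s)).
  - rewrite Lim_seq_opp. now destruct (Lim_seq (fun k => approx k t s)); simpl; try rewrite Ropp_0.
  - intros k. unfold approx. rewrite clamp_opp by lra. apply euler_opp.
Qed.

Lemma trajectory_order (t s s' : R) :
  0 <= t -> inI s -> inI s' -> trajectory t s - trajectory t s' <= Rabs (s - s').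
Proof.
  intros Ht Hs Hs'.
  refine (is_lim_seq_le (fun k => approx k t s - approx k t s')
    (fun k => Rabs (s - s') + 2 * t * modulus (2 * B) * (/ 2) ^ k)
    (Finite (trajectory t s - trajectory t s')) (Finite (Rabs (s - s'))) _ _ _).
  - intros k. unfold approx. rewrite !clamp_id by assumption.
    eapply Rle_trans; [apply euler_order; auto; apply pow_le; lra|].
    apply Rplus_le_compat_l, euler_error_le. now apply scaled_floor_le.
  - apply is_lim_seq_minus'; now apply approx_limit.
  - replace (Rabs (s - s')) with (Rabs (s - s') + 0) at 1 by ring.
    apply is_lim_seq_plus'; [apply is_lim_seq_const | apply half_pow_limit].
Qed.

Lemma trajectory_clamp (t s : R) : trajectory t (clamp 1 s) = trajectory t s.
Proof.
  unfold trajectory, approx. rewrite (clamp_id 1 (clamp 1 s)); [reflexivity|].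
  apply inI_clamp.
Qed.

Lemma trajectory_lipschitz (t s s' : R) : 0 <= t -> Rabs (trajectory t s - trajectory t s') <= Rabs (s - s').
Proof.
  intros Ht. rewrite <- (trajectory_clamp t s), <- (trajectory_clamp t s').
  apply Rle_trans with (Rabs (clamp 1 s - clamp 1 s')); [|apply clamp_lipschitz; lra].
  assert (H1 := trajectory_order t _ _ Ht (inI_clamp s) (inI_clamp s')).
  assert (H2 := trajectory_order t _ _ Ht (inI_clamp s') (inI_clamp s)).
  rewrite (Rabs_minus_sym (clamp 1 s')) in H2.
  apply Rabs_le_between. lra.
Qed.

Lemma trajectory_continuity (t : R) : 0 <= t -> continuity (trajectory t).
Proof.
  intros Ht s eps Heps. exists eps. split; [exact Heps|].
  intros s' [_ Hs']. simpl in *. unfold R_dist in *.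
  eapply Rle_lt_trans; [now apply trajectory_lipschitz | exact Hs'].
Qed.

Lemma modulus_continuity (d : R) : 0 <= d -> continuity_pt modulus d.
Proof.
  intros Hd. unfold modulus.
  apply (continuity_pt_scal (fun d => H * sqrt (2 * d)) 2).
  apply (continuity_pt_scal (fun d => sqrt (2 * d)) H).
  apply (continuity_pt_comp (fun d => 2 * d) sqrt).
  - apply (continuity_pt_scal id 2). apply derivable_continuous_pt, derivable_pt_id.
  - apply continuity_pt_sqrt. lra.
Qed.

Lemma modulus_limit (e : nat -> R) (d : R) :
  0 <= d -> is_lim_seq e d -> is_lim_seq (fun k => modulus (e k)) (modulus d).
Proof. intros Hd He. apply is_lim_seq_continuous; [now apply modulus_continuity | exact He]. Qed.

Lemma drift_approx_limit (t s : R) :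
  0 <= t -> inI s ->
  is_lim_seq (fun k => drift (euler ((/ 4) ^ k) (floor_nat (t * 4 ^ k))) s) (drift (trajectory t) s).
Proof.
  intros Ht Hs.
  apply (limit_of_dist _ (fun k => modulus (2 * rate t * (/ 2) ^ k))).
  - intros k. apply drift_holder; auto; [apply euler_continuity | now apply trajectory_continuity |].
    intros a Ha. generalize (proj2 (approx_limit t a Ht) k).
    unfold approx. now rewrite clamp_id.
  - replace 0 with (modulus 0).
    + apply modulus_limit; [lra | apply half_pow_limit].
    + unfold modulus. rewrite Rmult_0_r, sqrt_0. ring.
Qed.

(** Both end points matter: [t = t1] yields the derivative to the right, [t = t2] the one to the
    left and the implicit form that [decay_step] applies at the maximum of the later time. *)
Lemma trajectory_increment (t1 t2 t s : R) :
  0 <= t1 <= t2 -> t = t1 \/ t = t2 -> inI s ->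
  Rabs (trajectory t2 s - trajectory t1 s - (t2 - t1) * drift (trajectory t) s)
    <= (t2 - t1) * modulus (2 * B * (t2 - t1)).
Proof.
  intros H12 Htt Hs.
  set (h k := (/ 4) ^ k). set (n1 k := floor_nat (t1 * 4 ^ k)).
  set (n2 k := floor_nat (t2 * 4 ^ k)). set (n k := floor_nat (t * 4 ^ k)).
  set (w k := INR (n2 k - n1 k) * h k).
  assert (Hh : forall k, 0 < h k) by (intros k; apply pow_lt; lra).
  assert (Hh0 : is_lim_seq h 0).
  { apply is_lim_seq_geom. rewrite Rabs_pos_eq; lra. }
  assert (Hn : forall k, (n1 k <= n2 k)%nat).
  { intros k. apply floor_nat_le.
    - apply Rmult_le_pos; [lra | apply pow_le; lra].
    - apply Rmult_le_compat_r; [apply pow_le; lra | lra]. }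
  assert (Hw : is_lim_seq w (t2 - t1)).
  { apply (limit_of_dist _ h); [|exact Hh0]. intros k. unfold w.
    rewrite minus_INR by apply Hn. unfold n1, n2, h.
    generalize (scaled_floor_le k t1 ltac:(lra)) (scaled_floor_gt k t1 ltac:(lra))
      (scaled_floor_le k t2 ltac:(lra)) (scaled_floor_gt k t2 ltac:(lra)).
    intros. apply Rabs_le_between. lra. }
  assert (Ht : 0 <= t) by (destruct Htt; lra).
  refine (is_lim_seq_le
    (fun k => Rabs (euler (h k) (n2 k) s - euler (h k) (n1 k) s
                    - w k * drift (euler (h k) (n k)) s))
    (fun k => w k * modulus (2 * B * w k))
    (Finite (Rabs (trajectory t2 s - trajectory t1 s - (t2 - t1) * drift (trajectory t) s)))
    (Finite ((t2 - t1) * modulus (2 * B * (t2 - t1)))) _ _ _).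
  - intros k. specialize (Hn k). specialize (Hh k). unfold w, n.
    destruct Htt as [-> | ->].
    + generalize (euler_increment_forward (h k) (n1 k) (n2 k - n1 k) s ltac:(lra) Hs).
      now replace (n1 k + (n2 k - n1 k))%nat with (n2 k) by lia.
    + generalize (euler_increment_backward (h k) (n1 k) (n2 k - n1 k) s ltac:(lra) Hs).
      now replace (n1 k + (n2 k - n1 k))%nat with (n2 k) by lia.
  - apply (is_lim_seq_abs _ (Finite _)). apply is_lim_seq_minus'.
    + assert (Hlim : forall t0, 0 <= t0 ->
        is_lim_seq (fun k => euler (h k) (floor_nat (t0 * 4 ^ k)) s) (trajectory t0 s)).
      { intros t0 Ht0. apply (is_lim_seq_ext (fun k => approx k t0 s)).
        - intros k. unfold approx. now rewrite clamp_id.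
        - now apply approx_limit. }
      apply is_lim_seq_minus'; apply Hlim; lra.
    + apply is_lim_seq_mult'; [exact Hw | now apply drift_approx_limit].
  - apply is_lim_seq_mult'; [exact Hw|]. apply modulus_limit; [nra|].
    now apply (is_lim_seq_scal_l w (2 * B) (Finite (t2 - t1))).
Qed.

Lemma trajectory_increment_abs (t t' s : R) :
  0 <= t -> 0 <= t' -> inI s ->
  Rabs (trajectory t' s - trajectory t s - (t' - t) * drift (trajectory t) s)
    <= Rabs (t' - t) * modulus (2 * B * Rabs (t' - t)).
Proof.
  intros Ht Ht' Hs. destruct (Rle_dec t t') as [Hle|Hle].
  - rewrite (Rabs_pos_eq (t' - t)) by lra. apply trajectory_increment; auto.
  - rewrite (Rabs_left (t' - t)) by lra.
    replace (- (t' - t)) with (t - t') by ring.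
    replace (trajectory t' s - trajectory t s - (t' - t) * drift (trajectory t) s)
      with (- (trajectory t s - trajectory t' s - (t - t') * drift (trajectory t) s)) by ring.
    rewrite Rabs_Ropp. apply trajectory_increment; auto; lra.
Qed.

Lemma trajectory_deriv (t s : R) :
  0 <= t -> inI s -> deriv_half_line (fun r => trajectory r s) t (drift (trajectory t) s).
Proof.
  intros Ht Hs eps Heps.
  destruct (modulus_small (eps / 2)) as [d [Hd Hmod]]; [lra|].
  exists (d / (2 * B)). split; [apply Rdiv_lt_0_compat; lra|].
  intros h Hh Hth Hlt.
  assert (Hinc := trajectory_increment_abs t (t + h) s Ht Hth Hs).
  replace (t + h - t) with h in Hinc by ring.
  assert (Hm : modulus (2 * B * Rabs h) <= eps / 2).
  { apply Hmod. apply Rlt_le. replace d with (2 * B * (d / (2 * B))) by (field; lra).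
    apply Rmult_lt_compat_l; lra. }
  replace ((trajectory (t + h) s - trajectory t s) / h - drift (trajectory t) s)
    with ((trajectory (t + h) s - trajectory t s - h * drift (trajectory t) s) / h) by (field; exact Hh).
  unfold Rdiv. rewrite Rabs_mult, Rabs_inv.
  assert (Hp := Rabs_pos_lt h Hh).
  apply Rle_lt_trans with (eps / 2); [|lra].
  apply (Rmult_le_reg_r (Rabs h)); [exact Hp|].
  rewrite Rmult_assoc, Rinv_l, Rmult_1_r by lra. nra.
Qed.

Lemma trajectory_jointly_continuous (t s eps : R) :
  0 <= t -> inI s -> 0 < eps -> exists delta, 0 < delta /\
    forall t' s', 0 <= t' -> inI s' -> Rabs (t' - t) < delta -> Rabs (s' - s) < delta ->
      Rabs (trajectory t' s' - trajectory t s) < eps.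
Proof.
  intros Ht Hs Heps. set (L := 2 * B + modulus (2 * B)).
  assert (HL : 0 < L) by (unfold L; generalize (modulus_pos (2 * B)); lra).
  exists (Rmin 1 (eps / (1 + L))). split.
  { apply Rmin_glb_lt; [lra | apply Rdiv_lt_0_compat; lra]. }
  intros t' s' Ht' Hs' Htt Hss.
  assert (Hd1 := Rmin_l 1 (eps / (1 + L))). assert (Hd2 := Rmin_r 1 (eps / (1 + L))).
  set (d := Rmin 1 (eps / (1 + L))) in *.
  assert (H1 := trajectory_lipschitz t' s' s Ht').
  assert (H2 := trajectory_increment_abs t t' s Ht Ht' Hs).
  assert (H3 : modulus (2 * B * Rabs (t' - t)) <= modulus (2 * B)) by (apply modulus_le; nra).
  assert (H4 := drift_bound (trajectory t) s (trajectory_continuity t Ht)).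
  assert (H5 : Rabs (trajectory t' s - trajectory t s) <= Rabs (t' - t) * L).
  { replace (trajectory t' s - trajectory t s)
      with ((trajectory t' s - trajectory t s - (t' - t) * drift (trajectory t) s)
            + (t' - t) * drift (trajectory t) s) by ring.
    eapply Rle_trans; [apply Rabs_triang|]. rewrite (Rabs_mult (t' - t)).
    unfold L. generalize (Rabs_pos (t' - t)). nra. }
  replace (trajectory t' s' - trajectory t s)
    with ((trajectory t' s' - trajectory t' s) + (trajectory t' s - trajectory t s)) by ring.
  eapply Rle_lt_trans; [apply Rabs_triang|].
  apply Rlt_le_trans with (d + d * L); [nra|].
  replace (d + d * L) with (d * (1 + L)) by ring.
  apply Rle_trans with (eps / (1 + L) * (1 + L)); [|right; field; lra].
  apply Rmult_le_compat_r; lra.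
Qed.

(** * Extinction in finite time *)

Hypothesis F_attracts : forall x, 0 <= x <= 4 -> F x <= - sqrt x.

(* As [int y = 0] by oddness, concavity of the square root on [0, 2 c] turns
   the mean of [c - y] into the lower bound [sqrt (2 c)] of the attraction. *)
Lemma drift_at_maximum (y : R -> R) (s : R) :
  continuity y -> (forall a, y (- a) = - y a) ->
  0 < y s <= 2 -> (forall a, inI a -> Rabs (y a) <= y s) ->
  drift y s <= - sqrt (2 * y s).
Proof.
  intros Hy Hodd [Hc Hc2] Hmax. set (c := y s) in *.
  assert (Hq : 0 < sqrt (2 * c)) by (apply sqrt_lt_R0; lra).
  assert (Hqq : sqrt (2 * c) * sqrt (2 * c) = 2 * c) by (apply sqrt_sqrt; lra).
  set (q := sqrt (2 * c)) in *.
  (* The chord [(c - y) / q] of the square root is affine in [y], so its integral sees only the mean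
     of [y], and [2 * c / q = q]. *)
  assert (Hint : is_RInt (fun a => / q * y a + - c / q) (-1) 1 (- q)).
  { replace (- q) with (plus (scal (/ q) (RInt y (-1) 1)) (scal (1 - -1) (- c / q))).
    - apply (is_RInt_plus (V := R_NormedModule)).
      + apply (is_RInt_scal (V := R_NormedModule)).
        apply (RInt_correct (V := R_CompleteNormedModule)).
        now apply ex_RInt_continuity.
      + apply (is_RInt_const (V := R_NormedModule)).
    - rewrite RInt_odd by assumption. unfold plus, scal; simpl. unfold mult; simpl.
      replace (/ q * 0 + (1 - -1) * (- c / q)) with (- (2 * c) / q) by (field; lra).
      rewrite <- Hqq. field; lra. }
  rewrite <- (is_RInt_unique _ _ _ _ Hint).
  unfold drift. apply RInt_le; [lra | now apply integrand_ex_RInt | now exists (- q) |].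
  intros a Ha. fold c.
  assert (Hya := Hmax a ltac:(unfold inI; lra)). apply Rabs_le_between in Hya.
  eapply Rle_trans; [apply F_attracts; lra|].
  assert (Hr : sqrt (c - y a) <= q) by (apply sqrt_le_1_alt; lra).
  assert (Hr0 := sqrt_pos (c - y a)).
  assert (Hrr : sqrt (c - y a) * sqrt (c - y a) = c - y a) by (apply sqrt_sqrt; lra).
  set (r := sqrt (c - y a)) in *.
  replace (/ q * y a + - c / q) with (- ((c - y a) / q)) by (field; lra).
  apply Ropp_le_contravar. apply (Rmult_le_reg_r q); [exact Hq|].
  unfold Rdiv. rewrite Rmult_assoc, Rinv_l, Rmult_1_r by lra. rewrite <- Hrr. nra.
Qed.

Definition bounded_at (t c : R) : Prop := forall s, inI s -> Rabs (trajectory t s) <= c.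

(** The particle [p] that is rightmost at the later time is followed backwards; by oddness its
    position is also the largest absolute value. Either it is already within [m], or the attraction
    acting on it is bounded below in terms of [sqrt m]. *)
Lemma decay_step (t c m delta : R) :
  0 <= t -> 0 < m -> c <= 1 -> bounded_at t c ->
  0 <= delta -> delta * (2 * B + 1) <= 1 ->
  modulus (2 * B * delta) <= sqrt m / 4 -> m <= 1 ->
  bounded_at (t + delta) (Rmax m (c - delta * sqrt m)).
Proof.
  intros Ht Hm Hc1 Hc Hd HdB Hmod Hm1.
  assert (Ht' : 0 <= t + delta) by lra.
  destruct (continuity_ab_maj (trajectory (t + delta)) (-1) 1) as [p [Hmax Hp]].
  { lra. }
  { intros a _. now apply trajectory_continuity. }
  assert (Habs : forall a, inI a -> Rabs (trajectory (t + delta) a) <= trajectory (t + delta) p).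
  { intros a Ha. assert (Ha' : -1 <= - a <= 1) by (unfold inI in Ha; lra).
    generalize (Hmax a Ha) (Hmax _ Ha'). rewrite trajectory_opp. intros H1 H2.
    apply Rabs_le_between. lra. }
  intros s Hs. eapply Rle_trans; [now apply Habs|].
  destruct (Rle_lt_dec (trajectory (t + delta) p) m) as [Hle|Hlt].
  { eapply Rle_trans; [exact Hle | apply Rmax_l]. }
  eapply Rle_trans; [|apply Rmax_r].
  assert (Hsm := sqrt_lt_R0 m Hm).
  assert (Hsm1 : sqrt m <= 1) by (rewrite <- sqrt_1; now apply sqrt_le_1_alt).
  assert (Hinc := trajectory_increment t (t + delta) (t + delta) p ltac:(lra) (or_intror eq_refl) Hp).
  replace (t + delta - t) with delta in Hinc by ring.
  assert (HU := drift_bound (trajectory (t + delta)) p (trajectory_continuity _ Ht')).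
  specialize (Hc p Hp). apply Rabs_le_between in Hc, Hinc, HU.
  assert (HUm : drift (trajectory (t + delta)) p <= - sqrt (2 * trajectory (t + delta) p)).
  { apply drift_at_maximum; auto.
    - now apply trajectory_continuity.
    - intros a; apply trajectory_opp.
    (* At the later time only the crude bound 2 is known so far, so distances up to 4 occur; hence
       the range in [F_attracts]. *)
    - split; [lra|]. nra. }
  (* This holds as [25 / 16 <= 2]; the surplus [sqrt m / 4] pays for the error bounded by [Hmod]. *)
  assert (Hsq : 5 / 4 * sqrt m <= sqrt (2 * trajectory (t + delta) p)).
  { rewrite <- (sqrt_square (5 / 4)) by lra. rewrite <- sqrt_mult_alt by lra.
    apply sqrt_le_1_alt. lra. }
  nra.
Qed.

(** The floor [m] keeps the attraction away from 0, so that one admissible step length, depending on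
    [m], serves all steps into which [tau] is cut. *)
Lemma decay (t c m tau : R) :
  0 <= t -> 0 < m <= 1 -> c <= 1 -> bounded_at t c -> 0 <= tau ->
  bounded_at (t + tau) (Rmax m (c - tau * sqrt m)).
Proof.
  intros Ht Hm Hc1 Hc Htau.
  assert (Hsm := sqrt_lt_R0 m (proj1 Hm)).
  destruct (modulus_small (sqrt m / 4)) as [d [Hd Hmod]]; [lra|].
  (* The summand [2 * B + 1] provides the bound on the displacement in one step, [2 * B / d] the
     smallness of the modulus. *)
  destruct (INR_unbounded (tau * (2 * B + 1 + 2 * B / d))) as [N HN].
  assert (HBd : 0 < 2 * B / d) by (apply Rdiv_lt_0_compat; lra).
  assert (HN0 : 0 < INR N) by nra.
  set (delta := tau / INR N).
  assert (Htd : tau = INR N * delta) by (unfold delta; field; lra).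
  assert (Hdelta : 0 <= delta).
  { unfold delta. apply Rmult_le_pos; [lra | apply Rlt_le, Rinv_0_lt_compat; lra]. }
  assert (Hsmall : delta * (2 * B + 1 + 2 * B / d) <= 1).
  { apply (Rmult_le_reg_l (INR N)); [exact HN0|].
    rewrite <- Rmult_assoc, <- Htd. lra. }
  assert (HBd' : 2 * B * delta <= d).
  { assert (2 * B * delta = (delta * (2 * B / d)) * d) by (field; lra). nra. }
  assert (Hiter : forall i,
    bounded_at (t + INR i * delta) (Rmax m (c - INR i * delta * sqrt m))).
  { induction i as [|i IH].
    - simpl. rewrite !Rmult_0_l, Rplus_0_r, Rminus_0_r.
      intros s Hs. eapply Rle_trans; [now apply Hc | apply Rmax_r].
    - assert (Hi : 0 <= INR i * delta) by (apply Rmult_le_pos; [apply pos_INR | assumption]).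
      rewrite S_INR. replace (t + (INR i + 1) * delta) with (t + INR i * delta + delta) by ring.
      intros s Hs. eapply Rle_trans.
      + apply (decay_step (t + INR i * delta) (Rmax m (c - INR i * delta * sqrt m)) m delta);
          try assumption; try lra.
        * apply Rmax_lub; nra.
        * nra.
        * now apply Hmod.
      + apply Rmax_lub; [apply Rmax_l|].
        generalize (Rmax_l m (c - (INR i + 1) * delta * sqrt m))
          (Rmax_r m (c - (INR i + 1) * delta * sqrt m)).
        unfold Rmax at 3. destruct Rle_dec; nra. }
  rewrite Htd. apply Hiter.
Qed.

Lemma trajectory_bounded (t : R) : 0 <= t -> bounded_at t 1.
Proof.
  intros Ht s Hs.
  assert (H0 : bounded_at 0 1).
  { intros a Ha. rewrite trajectory_start by assumption. unfold inI in Ha.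
    apply Rabs_le_between. lra. }
  (* With [m = c], [decay] says that a radius once reached is never exceeded again. *)
  assert (H1 := decay 0 1 1 t ltac:(lra) ltac:(lra) ltac:(lra) H0 Ht s Hs).
  rewrite Rplus_0_l in H1. eapply Rle_trans; [exact H1|].
  apply Rmax_lub; [lra|]. rewrite sqrt_1. lra.
Qed.

(* Shrinking from radius [4^-j] to [4^-(j+1)] takes time at most [2 * 2^-j]. *)
Lemma trajectory_geometric_decay (j : nat) : bounded_at (4 * (1 - (/ 2) ^ j)) ((/ 4) ^ j).
Proof.
  induction j as [|j IH].
  - simpl. replace (4 * (1 - 1)) with 0 by ring. apply trajectory_bounded; lra.
  - assert (Hp : 0 < (/ 2) ^ j) by (apply pow_lt; lra).
    assert (Hp1 : (/ 2) ^ j <= 1) by (rewrite <- (pow1 j); apply pow_incr; lra).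
    rewrite pow_quarter in IH. rewrite pow_quarter.
    simpl pow. set (p := (/ 2) ^ j) in *.
    assert (Hsq : sqrt (/ 2 * p * (/ 2 * p)) = / 2 * p) by (apply sqrt_square; lra).
    intros s Hs.
    (* The duration [2 * p] is the one for which [c - tau * sqrt m] vanishes, with [c = p^2] and
       [sqrt m = p / 2]. *)
    assert (H1 := decay (4 * (1 - p)) (p * p) (/ 2 * p * (/ 2 * p)) (2 * p)
                    ltac:(lra) ltac:(nra) ltac:(nra) IH ltac:(lra) s Hs).
    rewrite Hsq in H1.
    replace (4 * (1 - / 2 * p)) with (4 * (1 - p) + 2 * p) by field.
    eapply Rle_trans; [exact H1|]. apply Rmax_lub; nra.
Qed.

(** The durations [2 * 2^-j] sum to 4, so every radius [4^-j] is reached before time 4 and not left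
    afterwards. *)
Lemma trajectory_extinction (t s : R) : 4 <= t -> inI s -> trajectory t s = 0.
Proof.
  intros Ht Hs.
  assert (Hj : forall j, Rabs (trajectory t s) <= (/ 4) ^ j).
  { intros j. assert (Hp : 0 < (/ 4) ^ j) by (apply pow_lt; lra).
    assert (Hp1 : (/ 4) ^ j <= 1) by (rewrite <- (pow1 j); apply pow_incr; lra).
    assert (Hq : 0 < (/ 2) ^ j) by (apply pow_lt; lra).
    assert (Hq1 : (/ 2) ^ j <= 1) by (rewrite <- (pow1 j); apply pow_incr; lra).
    assert (H1 := decay (4 * (1 - (/ 2) ^ j)) ((/ 4) ^ j) ((/ 4) ^ j)
                    (t - 4 * (1 - (/ 2) ^ j)) ltac:(lra) ltac:(lra) Hp1
                    (trajectory_geometric_decay j) ltac:(lra) s Hs).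
    replace (4 * (1 - (/ 2) ^ j) + (t - 4 * (1 - (/ 2) ^ j))) with t in H1 by ring.
    eapply Rle_trans; [exact H1|]. apply Rmax_lub; [lra|].
    generalize (sqrt_pos ((/ 4) ^ j)). nra. }
  destruct (Req_dec (trajectory t s) 0) as [H0|H0]; [exact H0|].
  destruct (pow_lt_1_zero (/ 4) ltac:(rewrite Rabs_pos_eq; lra) _ (Rabs_pos_lt _ H0))
    as [N HN].
  specialize (HN N (le_n N)). rewrite Rabs_pos_eq in HN by (apply pow_le; lra).
  specialize (Hj N). lra.
Qed.

End Flow.

(** * The flow of the segment *)

(** The kernel on the axis is not monotone on the whole line, since it has compact support; the
    truncation makes the force antitone everywhere, as the section [Flow] demands. It has no effect
    on the flow, whose particles stay within distance 2 of each other by [trajectory_bounded]. *)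
Definition axis_force (x : R) : R := - kappa2 (clamp 2 x, 0).

Lemma axis_force_odd (x : R) : axis_force (- x) = - axis_force x.
Proof. unfold axis_force. now rewrite clamp_opp, kappa2_axis_opp by lra. Qed.

Lemma axis_force_antitone (x y : R) : x <= y -> axis_force y <= axis_force x.
Proof.
  intros Hxy. unfold axis_force. apply Ropp_le_contravar.
  apply kappa2_axis_monotone; [apply clamp_range; lra | now apply clamp_le | apply clamp_range; lra].
Qed.

Lemma axis_force_holder :
  exists C, 0 < C /\ forall x y,
    Rabs (axis_force x - axis_force y) <= C * sqrt (Rabs (x - y)).
Proof.
  destruct kappa2_holder as [C [HC HK]]. exists (C + 1). split; [lra|].
  intros x y. unfold axis_force.
  replace (- kappa2 (clamp 2 x, 0) - - kappa2 (clamp 2 y, 0))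
    with (- (kappa2 (clamp 2 x, 0) - kappa2 (clamp 2 y, 0))) by ring.
  rewrite Rabs_Ropp. eapply Rle_trans; [apply HK|]. rewrite vsub_axis, norm2_axis.
  apply Rmult_le_compat; [lra | apply sqrt_pos | lra |].
  apply sqrt_le_1_alt, clamp_lipschitz; lra.
Qed.

Lemma axis_force_bounded : exists B, 0 < B /\ forall x, Rabs (axis_force x) <= B.
Proof.
  (* By antitonicity and oddness the extreme values are taken at 2 and -2; the summand 1 makes the
     bound positive. *)
  exists (1 - axis_force 2).
  assert (H0 : axis_force 0 = 0) by (generalize (axis_force_odd 0); rewrite Ropp_0; lra).
  assert (H2 := axis_force_antitone 0 2 ltac:(lra)).
  split; [lra|]. intros x.
  assert (Hc : axis_force x = axis_force (clamp 2 x)).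
  { unfold axis_force. rewrite (clamp_id 2 (clamp 2 x)); [reflexivity|]. apply clamp_range; lra. }
  assert (Hr := clamp_range 2 x ltac:(lra)). rewrite Hc.
  assert (H3 := axis_force_antitone (clamp 2 x) 2 ltac:(lra)).
  assert (H4 := axis_force_antitone (- (2)) (clamp 2 x) ltac:(lra)).
  rewrite axis_force_odd in H4. apply Rabs_le_between. lra.
Qed.

Lemma axis_force_attracts (x : R) : 0 <= x <= 4 -> axis_force x <= - sqrt x.
Proof.
  intros Hx. unfold axis_force. apply Ropp_le_contravar.
  assert (Hc : 0 <= clamp 2 x <= 2 /\ x <= 2 * 2 * clamp 2 x).
  { unfold clamp, Rmax, Rmin. repeat destruct Rle_dec; lra. }
  eapply Rle_trans; [|now apply kappa2_axis_lower].
  rewrite <- (sqrt_square 2) at 1 by lra. rewrite <- sqrt_mult_alt by lra.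
  apply sqrt_le_1_alt, Hc.
Qed.

Lemma has_integral_of_is_RInt (f : R -> R) (a b v : R) : is_RInt f a b v -> has_integral f a b v.
Proof.
  intros Hf. assert (Hex : ex_RInt f a b) by now exists v.
  exists (ex_RInt_Reals_0 f a b Hex). rewrite <- RInt_Reals. now apply is_RInt_unique.
Qed.

Lemma axis_velocity (y : R -> R) (t s : R) (X : R -> R -> pt) :
  continuity y -> (forall a, X t a = (y a, 0)) ->
  inI s -> (forall a, inI a -> Rabs (y a) <= 1) ->
  ex_RInt (fun a => axis_force (y s - y a)) (-1) 1 ->
  velocity (perp_grad kappa1 kappa2) X t (X t s) (drift axis_force y s, 0).
Proof.
  intros Hy HX Hs Hb Hex. unfold velocity; simpl. split; apply has_integral_of_is_RInt.
  - apply (is_RInt_ext (V := R_NormedModule) (fun a => axis_force (y s - y a))).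
    (* Here the truncation disappears: positions in [[-1, 1]] differ by at most 2. *)
    + intros a Ha. rewrite !HX, vsub_axis. unfold axis_force. rewrite clamp_id; [reflexivity|].
      rewrite Rmin_left, Rmax_right in Ha by lra.
      assert (Ha' : inI a) by (unfold inI; lra).
      generalize (Hb s Hs) (Hb a Ha'). intros H1 H2.
      apply Rabs_le_between in H1, H2. lra.
    + now apply (RInt_correct (V := R_CompleteNormedModule)).
  - apply (is_RInt_ext (V := R_NormedModule) (fun _ => 0)).
    + intros a _. now rewrite !HX, vsub_axis, kappa1_axis.
    + assert (H0 : is_RInt (fun _ => 0) (-1) 1 ((1 - -1) * 0))
        by apply (is_RInt_const (V := R_NormedModule)).
      now rewrite Rmult_0_r in H0.
Qed.

Lemma deriv_half_line_const (c t : R) : deriv_half_line (fun _ => c) t 0.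
Proof.
  intros eps Heps. exists 1. split; [lra|]. intros h Hh _ _.
  replace ((c - c) / h - 0) with 0 by (field; exact Hh). now rewrite Rabs_R0.
Qed.

Theorem theorem3p2 :
  exists (kappa g1 g2 : pt -> R) (X : R -> R -> pt),
    C11half_c kappa g1 g2 /\
    admits_flow (perp_grad g1 g2) X /\
    (forall s, inI s -> X 0 s = (s, 0)) /\
    (exists T, 0 < T /\ forall t, T <= t -> forall s, inI s -> X t s = (0, 0)).
Proof.
  destruct axis_force_holder as [H [H_pos Hholder]].
  destruct axis_force_bounded as [B [B_pos Hbound]].
  assert (Hodd := axis_force_odd). assert (Hanti := axis_force_antitone).
  assert (Hattr := axis_force_attracts).
  set (X := fun t s => (trajectory axis_force t s, 0) : pt).
  assert (Hcont : forall t, 0 <= t -> continuity (trajectory axis_force t))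
    by exact (trajectory_continuity axis_force H B H_pos B_pos Hanti Hholder Hbound).
  assert (Hstart : forall s, inI s -> X 0 s = (s, 0)).
  { intros s Hs. unfold X. f_equal. now apply trajectory_start. }
  assert (Hvel : forall t s, 0 <= t -> inI s ->
    velocity (perp_grad kappa1 kappa2) X t (X t s) (drift axis_force (trajectory axis_force t) s, 0)).
  { intros t s Ht Hs. apply axis_velocity; auto.
    - now apply (trajectory_bounded axis_force H B H_pos B_pos Hodd Hanti Hholder Hbound Hattr).
    - apply (integrand_ex_RInt axis_force H H_pos Hholder). auto. }
  exists kappa, kappa1, kappa2, X.
  split; [exact kappa_C11half_c|]. split; [|split; [exact Hstart|]].
  - split; [|split; [|split; [exact Hstart|]]].
    + intros t s Ht Hs eps Heps.
      destruct (trajectory_jointly_continuous axis_force H B H_pos B_pos Hanti Hholder Hbound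
                  t s eps Ht Hs Heps) as [d [Hd Hclose]].
      exists d. split; [exact Hd|]. intros t' s' Ht' Hs' Htt Hss.
      unfold X. rewrite vsub_axis, norm2_axis. now apply Hclose.
    + intros t x Ht [s [Hs <-]]. eexists. now apply Hvel.
    + intros t s Ht Hs. eexists. split; [now apply Hvel|]. simpl. split.
      * now apply (trajectory_deriv axis_force H B H_pos B_pos Hanti Hholder Hbound).
      * apply deriv_half_line_const.
  - exists 4. split; [lra|]. intros t Ht s Hs. unfold X. f_equal.
    now apply (trajectory_extinction axis_force H B H_pos B_pos Hodd Hanti Hholder Hbound Hattr).
Qed.
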